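(* Let $n\ge1$ and let $U$ be a Pisot numeration system. Let $P\subseteq\mathbb{N}^n$ be a $U$-definable set containing $\mathbf{0}$. Then it is decidable whether $P$ is a $1$-invariant set.
   Context: $\mathbb{N}=\{0,1,2,\ldots\}$. A Pisot number is a real algebraic integer $\alpha>1$ all of whose other Galois conjugates have modulus $<1$. A Pisot numeration system is an increasing integer sequence $U=(U_i)_{i\ge0}$ with $U_0=1$ satisfying a linear recurrence whose characteristic polynomial is the minimal polynomial of a Pisot number. Every $m\in\mathbb{N}$ has a greedy $U$-expansion $\mathrm{rep}_U(m)=c_\ell\cdots c_0$ with $m=\sum c_jU_j$, $\sum_{j\le r}c_jU_j<U_{r+1}$ for all $r\le\ell$, $c_\ell\ne0$. Let $V_U(m)$ be the smallest $U_i$ with $c_i\ne0$ in $\mathrm{rep}_U(m)$ for $m>0$, and $V_U(0)=1$. A set $X\subseteq\mathbb{N}^n$ is $U$-definable if it equals $\{(d_1,\ldots,d_n):\varphi(d_1,\ldots,d_n)\text{ holds}\}$ for some first-order formula $\varphi$ with free variables $x_1,\ldots,x_n$ in the structure $\langle\mathbb{N},+,V_U\rangle$ (variables range over $\mathbb{N}$, built from $+$, $V_U$, $=$, Boolean connectives and quantifiers over $\mathbb{N}$). Games: positions are elements of $\mathbb{N}^n$; moves are non-zero $\mathbf{m}\in\mathbb{N}^n$ applicable at $\mathbf{p}$ when $\mathbf{m}\le\mathbf{p}$ componentwise, leading to $\mathbf{p}-\mathbf{m}$. A game is a map $G:\mathbb{N}^n\to2^{\mathbb{N}^n}$ of allowed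 moves; it is $1$-invariant if $G(\mathbf{p})=I\cap\{\mathbf{m}:\mathbf{m}\le\mathbf{p}\}$ for a fixed $I\subseteq\mathbb{N}^n$. Under normal play, $\mathcal{P}(G)$ is the set of positions from which the player to move loses with best play. A set $X\subseteq\mathbb{N}^n$ is $1$-invariant if $X=\mathcal{P}(G)$ for some $1$-invariant game $G$. *)

(* Defs.v *)
From HB Require Import structures.
From mathcomp Require Import all_boot all_order all_algebra all_field.

Set Implicit Arguments.
Unset Strict Implicit.
Unset Printing Implicit Defensive.

Import Order.TTheory GRing.Theory Num.Theory.

(** * Pisot numeration systems *)

(** [1 < alpha] in [algC] entails that [alpha] is real; the Galois conjugates of
    [alpha] are the roots of its minimal polynomial over the rationals. *)
Definition pisot (alpha : algC) : Prop :=
  [/\ alpha \in Aint, (1 < alpha)%R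
    & forall beta : algC,
        root (minCpoly alpha) beta -> beta <> alpha -> (`|beta| < 1)%R].

Definition linear_recurrence (U : nat -> nat) (k : nat) (a : 'I_k -> int) : Prop :=
  forall i : nat,
    ((U (i + k)%N)%:Z = \sum_(j < k) a j * (U (i + j)%N)%:Z)%R.

Definition recurrence_poly (k : nat) (a : 'I_k -> int) : {poly int} :=
  ('X^k - \sum_(j < k) (a j)%:P * 'X^j)%R.

Definition pisot_numeration (U : nat -> nat) : Prop :=
  [/\ U 0 = 1,
      forall i, U i < U i.+1
    & exists k (a : 'I_k -> int) (alpha : algC),
        [/\ linear_recurrence U a, pisot alpha
          & map_poly intr (recurrence_poly a) = minCpoly alpha]].

(** Expansions are listed with the least significant digit first, so that
    [nth 0 c j] is the coefficient of [U j]; 0 has the empty expansion. *)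
Definition greedy_expansion (U : nat -> nat) (m : nat) (c : seq nat) : Prop :=
  [/\ m = \sum_(j < size c) nth 0 c j * U j,
      forall r, r < size c -> \sum_(j < r.+1) nth 0 c j * U j < U r.+1
    & last 1 c != 0].

Fixpoint greedy_digits (U : nat -> nat) (k m : nat) : seq nat :=
  if k is k'.+1 then rcons (greedy_digits U k' (m %% U k')) (m %/ U k')
  else [::].

(** When [U] is increasing with [U 0 = 1] we have [m < U m], so that the length
    below is the least [k] with [m < U k]. *)
Definition rep (U : nat -> nat) (m : nat) : seq nat :=
  greedy_digits U (find (fun k => m < U k) (iota 0 m.+1)) m.

Definition V (U : nat -> nat) (m : nat) : nat :=
  if m == 0 then 1 else U (find (fun c => c != 0) (rep U m)).

Section Greedy.
Variable U : nat -> nat.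
Hypotheses (U0 : U 0 = 1) (Uinc : forall i, U i < U i.+1).

Let U_gt i : i < U i.
Proof. by elim: i => [|i IH]; [rewrite U0 | exact: leq_ltn_trans (Uinc i)]. Qed.

Lemma size_greedy_digits k m : size (greedy_digits U k m) = k.
Proof. by elim: k m => //= k IH m; rewrite size_rcons IH. Qed.

Lemma greedy_digitsP k m : m < U k ->
  m = \sum_(j < k) nth 0 (greedy_digits U k m) j * U j /\
  forall r, r < k -> \sum_(j < r.+1) nth 0 (greedy_digits U k m) j * U j < U r.+1.
Proof.
elim: k m => [|k IH] m /=.
  by rewrite U0 ltnS leqn0 => /eqP ->; rewrite big_ord0.
move=> mU; have Uk0 : 0 < U k by exact: leq_ltn_trans (U_gt k).
have [IH1 IH2] := IH (m %% U k) (ltn_pmod m Uk0).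
set s := greedy_digits U k (m %% U k) in IH1 IH2 *.
have ss : size s = k by exact: size_greedy_digits.
have E r : r <= k ->
    \sum_(j < r) nth 0 (rcons s (m %/ U k)) j * U j = \sum_(j < r) nth 0 s j * U j.
  move=> rk; apply: eq_bigr => j _.
  by rewrite nth_rcons ss (leq_trans (ltn_ord j) rk).
have Em : m = \sum_(j < k.+1) nth 0 (rcons s (m %/ U k)) j * U j.
  by rewrite big_ord_recr /= E // -IH1 nth_rcons ss ltnn eqxx addnC -divn_eq.
split=> // r; rewrite ltnS leq_eqVlt => /orP[/eqP ->|rk]; first by rewrite -Em.
by rewrite E // IH2.
Qed.

Lemma repP m : greedy_expansion U m (rep U m).
Proof.
rewrite /rep; set p := fun k => m < U k; set k := find p _.
have hp : has p (iota 0 m.+1).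
  by apply/hasP; exists m; rewrite ?mem_iota //= /p U_gt.
have kS : k < m.+1 by move: hp; rewrite has_find size_iota.
have mk : m < U k by have := nth_find 0 hp; rewrite -/k nth_iota.
have [H1 H2] := greedy_digitsP mk.
rewrite /greedy_expansion size_greedy_digits; split=> //.
case Ek: k => [|k'] //=; rewrite last_rcons -lt0n divn_gt0.
  have k'k : k' < find p (iota 0 m.+1) by rewrite -/k Ek.
  have := before_find 0 k'k; rewrite nth_iota ?add0n /p.
    by move/negbT; rewrite -leqNgt.
  by rewrite (leq_trans k'k) // ltnW.
exact: leq_ltn_trans (U_gt k').
Qed.

Lemma greedy_expansion_digits m c :
  greedy_expansion U m c -> c = greedy_digits U (size c) m.
Proof.
case=> + + _; elim/last_ind: c m => [|c d IH] m //.
rewrite size_rcons big_ord_recr /= nth_rcons ltnn eqxx.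
have E r : r <= size c ->
    \sum_(j < r) nth 0 (rcons c d) j * U j = \sum_(j < r) nth 0 c j * U j.
  move=> rk; apply: eq_bigr => j _.
  by rewrite nth_rcons (leq_trans (ltn_ord j) rk).
rewrite E // => Em Hr; set s := \sum_(j < _) _ in Em.
have sU : s < U (size c).
  rewrite /s; case Ec: (size c) => [|k]; first by rewrite big_ord0 U0.
  have kc : k < size c by rewrite Ec.
  by have := Hr k (ltnW kc); rewrite E.
have Uk0 : 0 < U (size c) by exact: leq_ltn_trans (U_gt _).
have -> : m %% U (size c) = s by rewrite Em addnC modnMDl modn_small.
have -> : m %/ U (size c) = d by rewrite Em addnC divnMDl // divn_small // addn0.
congr rcons; apply: IH => // r rc.
by rewrite -E // Hr // ltnW.
Qed.

Lemma greedy_expansion_rep m c : greedy_expansion U m c -> c = rep U m.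
Proof.
have homo i j : i <= j -> U i <= U j.
  by elim: j => [|j IH]; rewrite leq_eqVlt => /orP[/eqP->|] // ij;
    exact: leq_trans (IH ij) (ltnW (Uinc j)).
have bounds c' : greedy_expansion U m c' ->
    m < U (size c') /\ forall k, k < size c' -> U k <= m.
  case=> Em Hr; case/lastP: c' Em Hr => [|c' d] Em Hr.
    by rewrite Em big_ord0 /= U0.
  rewrite last_rcons => d0; split.
    by rewrite Em; move: Hr; rewrite size_rcons; apply.
  move=> k; rewrite size_rcons ltnS => kc.
  rewrite Em size_rcons big_ord_recr /= nth_rcons ltnn eqxx.
  apply: leq_trans (leq_addl _ _); apply: leq_trans (homo _ _ kc) _.
  by rewrite leq_pmull // lt0n.
move=> Hc; have Hr := repP m.
rewrite (greedy_expansion_digits Hc) (greedy_expansion_digits Hr).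
have [c1 c2] := bounds _ Hc; have [r1 r2] := bounds _ Hr.
congr greedy_digits; apply/eqP; rewrite eqn_leq.
by apply/andP; split; rewrite leqNgt; apply/negP => h;
  [have := c2 _ h | have := r2 _ h]; rewrite leqNgt ?r1 ?c1.
Qed.

End Greedy.

(** * First-order formulas over the structure (N, +, V_U) *)

Inductive term : Type :=
| TVar of nat
| TAdd of term & term
| TV of term.

Inductive formula : Type :=
| FEq of term & term
| FNot of formula
| FAnd of formula & formula
| FOr of formula & formula
| FImp of formula & formula
| FEx of nat & formula
| FAll of nat & formula.

Fixpoint term_vars (t : term) : seq nat :=
  match t with
  | TVar x => [:: x]
  | TAdd t1 t2 => term_vars t1 ++ term_vars t2
  | TV t1 => term_vars t1
  end.

Fixpoint free_vars (phi : formula) : seq nat :=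
  match phi with
  | FEq t1 t2 => term_vars t1 ++ term_vars t2
  | FNot f => free_vars f
  | FAnd f g | FOr f g | FImp f g => free_vars f ++ free_vars g
  | FEx x f | FAll x f => [seq y <- free_vars f | y != x]
  end.

Fixpoint eval (U : nat -> nat) (v : nat -> nat) (t : term) : nat :=
  match t with
  | TVar x => v x
  | TAdd t1 t2 => eval U v t1 + eval U v t2
  | TV t1 => V U (eval U v t1)
  end.

Definition update (v : nat -> nat) (x d : nat) : nat -> nat :=
  fun y => if y == x then d else v y.

Fixpoint holds (U : nat -> nat) (v : nat -> nat) (phi : formula) : Prop :=
  match phi with
  | FEq t1 t2 => eval U v t1 = eval U v t2
  | FNot f => ~ holds U v f
  | FAnd f g => holds U v f /\ holds U v g
  | FOr f g => holds U v f \/ holds U v g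
  | FImp f g => holds U v f -> holds U v g
  | FEx x f => exists d, holds U (update v x d) f
  | FAll x f => forall d, holds U (update v x d) f
  end.

(** The free variables x_1, ..., x_n are numbered 0, ..., n-1. *)
Definition defines (U : nat -> nat) (n : nat) (phi : formula)
    (X : n.-tuple nat -> Prop) : Prop :=
  {in free_vars phi, forall x, x < n} /\
  forall d : n.-tuple nat, X d <-> holds U (nth 0 d) phi.

(** * Games *)

Definition origin (n : nat) : n.-tuple nat := [tuple 0 | i < n].

Definition le_pos (n : nat) (m p : n.-tuple nat) : Prop :=
  forall i : 'I_n, tnth m i <= tnth p i.

Definition sub_pos (n : nat) (p m : n.-tuple nat) : n.-tuple nat :=
  [tuple tnth p i - tnth m i | i < n].

Record game (n : nat) := Game {
  moves :> n.-tuple nat -> n.-tuple nat -> Prop;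
  moves_neq0 : forall p m, moves p m -> m <> origin n;
  moves_le : forall p m, moves p m -> le_pos m p }.

(** [losing G p] (resp. [winning G p]): under normal play, the player to move
    from [p] loses (resp. wins) with best play. *)
Inductive losing (n : nat) (G : game n) (p : n.-tuple nat) : Prop :=
| Losing of forall m, G p m -> winning G (sub_pos p m)
with winning (n : nat) (G : game n) (p : n.-tuple nat) : Prop :=
| Winning m of G p m & losing G (sub_pos p m).

Definition one_invariant_game (n : nat) (G : game n) : Prop :=
  exists I : n.-tuple nat -> Prop, forall p m, G p m <-> I m /\ le_pos m p.

Definition one_invariant (n : nat) (X : n.-tuple nat -> Prop) : Prop :=
  exists G : game n, one_invariant_game G /\ forall p, X p <-> losing G p.

(** * Decidability *)

(** Kleene's total recursive functions: minimisation is only applied to [g] such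
    that for every [t] some [y] satisfies [g (y :: t) = 0]. The functions are
    characterised by their defining equations, which makes the class closed
    under extensional equality. *)
Inductive recursive : forall k : nat, (k.-tuple nat -> nat) -> Prop :=
| rec_zero k (f : k.-tuple nat -> nat) :
    (forall t, f t = 0) -> recursive f
| rec_succ (f : 1.-tuple nat -> nat) :
    (forall t, f t = (thead t).+1) -> recursive f
| rec_proj k (i : 'I_k) (f : k.-tuple nat -> nat) :
    (forall t, f t = tnth t i) -> recursive f
| rec_comp k l (g : l.-tuple nat -> nat) (h : 'I_l -> k.-tuple nat -> nat)
    (f : k.-tuple nat -> nat) :
    recursive g -> (forall i, recursive (h i)) ->
    (forall t, f t = g [tuple h i t | i < l]) -> recursive f
| rec_prim k (g : k.-tuple nat -> nat) (h : k.+2.-tuple nat -> nat)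
    (f : k.+1.-tuple nat -> nat) :
    recursive g -> recursive h ->
    (forall t, f (cons_tuple 0 t) = g t) ->
    (forall x t, f (cons_tuple x.+1 t)
                 = h (cons_tuple x (cons_tuple (f (cons_tuple x t)) t))) ->
    recursive f
| rec_min k (g : k.+1.-tuple nat -> nat) (f : k.-tuple nat -> nat) :
    recursive g ->
    (forall t, g (cons_tuple (f t) t) = 0) ->
    (forall t y, y < f t -> g (cons_tuple y t) <> 0) ->
    recursive f.

(** Cantor's pairing function. *)
Definition cantor (x y : nat) : nat := 'C((x + y).+1, 2) + y.

Fixpoint code_term (t : term) : nat :=
  match t with
  | TVar x => cantor 0 x
  | TAdd t1 t2 => cantor 1 (cantor (code_term t1) (code_term t2))
  | TV t1 => cantor 2 (code_term t1)
  end.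

Fixpoint code (phi : formula) : nat :=
  match phi with
  | FEq t1 t2 => cantor 0 (cantor (code_term t1) (code_term t2))
  | FNot f => cantor 1 (code f)
  | FAnd f g => cantor 2 (cantor (code f) (code g))
  | FOr f g => cantor 3 (cantor (code f) (code g))
  | FImp f g => cantor 4 (cantor (code f) (code g))
  | FEx x f => cantor 5 (cantor x (code f))
  | FAll x f => cantor 6 (cantor x (code f))
  end.

(** The property [Q] is decidable on the [U]-definable subsets of N^n that
    satisfy [D]: one recursive function, independent of the set, computes the
    truth value of [Q X] from the Goedel number of any formula defining [X]. *)
Definition decidable_on_definable (U : nat -> nat) (n : nat)
    (D Q : (n.-tuple nat -> Prop) -> Prop) : Prop :=
  exists f : 1.-tuple nat -> nat,
    recursive f /\
    forall (X : n.-tuple nat -> Prop) (phi : formula),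
      defines U phi X -> D X ->
      (Q X -> f [tuple code phi] = 1) /\ (~ Q X -> f [tuple code phi] = 0).

(* Main.v *)
Require Import Defs.
From HB Require Import structures.
From mathcomp Require Import all_boot all_order all_algebra all_field.
From mathcomp Require Import boolp zify ring lra.

Set Implicit Arguments.
Unset Strict Implicit.
Unset Printing Implicit Defensive.

Import Order.TTheory GRing.Theory Num.Theory.

(** One-invariance of [X] is first-order expressible over [X]: every position
    outside [X] must be [p + m] with [p] in [X] and [m] not a difference of two
    elements of [X]. It thus suffices to decide the theory of [(N, +, V_U)].

    Writing [U_i = c alpha^i + delta_i], the Pisot property makes [delta]
    absolutely summable. Hence, when a word of bounded signed digits is read from
    the most significant digit on, the vector of its [k] first shifted values is
    either bounded or already decides the sign of the final value. This gives
    finite automata for addition and for the language of greedy expansions, and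
    by the subset construction for all formulas. These automata need not be
    computed: only the number of their states matters, which is at most a tower of
    exponentials in the code of the formula. By pumping, a quantified variable may
    then be restricted to a computable initial segment of N, and bounded
    quantification is evaluated by a course-of-values recursion. *)

(** * Recursive functions *)

(** The automata come from a real constant and from classical set comprehension, so they have no
    effective content. But [U] is fixed before the recursive function is chosen, so one number [K]
    bounding the sizes of the basic automata can be built into that function as a constant; all
    other sizes follow from it by arithmetic. The sign of a value is tracked, and not just its
    vanishing, because an expansion is greedy when an inequality holds for each of its suffixes.
    Greediness has to be checked along with every quantifier, where the digits of the witness are
    guessed. A witness may need more digits than the parameters have. Its excess digits are read
    while all parameters have digit 0, so pumping bounds their number independently of the
    parameters. Each quantifier therefore lengthens the numbers in play by a constant amount, and
    the whole range is known before evaluation starts. *)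

Definition recs (k : nat) (f : seq nat -> nat) : Prop :=
  recursive (fun t : k.-tuple nat => f t).

Lemma recs_ext k f g :
  recs k f -> (forall s, size s = k -> f s = g s) -> recs k g.
Proof.
rewrite /recs => Hf E.
suff -> : (fun t : k.-tuple nat => g t) = (fun t : k.-tuple nat => f t) by [].
by apply: funext => t; rewrite E ?size_tuple.
Qed.

Lemma recs_var k i : i < k -> recs k (nth 0 ^~ i).
Proof.
by move=> ik; apply: (@rec_proj _ (Ordinal ik)) => t; rewrite (tnth_nth 0).
Qed.

Lemma recs_comp k (g : seq nat -> nat) (fs : seq (seq nat -> nat)) :
  recs (size fs) g -> (forall i, i < size fs -> recs k (nth (fun=> 0) fs i)) ->
  recs k (fun s => g [seq f s | f <- fs]).
Proof.
move=> Hg Hf.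
apply: (@rec_comp _ _ _ (fun i (t : k.-tuple nat) => nth (fun=> 0) fs i t) _ Hg).
  by move=> i; exact: Hf.
move=> t; congr g; apply: (@eq_from_nth _ 0); first by rewrite size_map size_tuple.
move=> i; rewrite size_map => ik.
rewrite (nth_map (fun=> 0)) //.
by rewrite -[i]/(nat_of_ord (Ordinal ik)) -tnth_nth tnth_mktuple.
Qed.

Lemma recs_zero k : recs k (fun=> 0).
Proof. exact: rec_zero. Qed.

(* A function symbol is [Rn] when it may be applied to computable arguments in
   any context; this is what makes the closure lemmas applicable by unification. *)
Definition R1 (g : nat -> nat) := forall k f, recs k f -> recs k (fun s => g (f s)).
Definition R2 (g : nat -> nat -> nat) := forall k f1 f2,
  recs k f1 -> recs k f2 -> recs k (fun s => g (f1 s) (f2 s)).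
Definition R3 (g : nat -> nat -> nat -> nat) := forall k f1 f2 f3,
  recs k f1 -> recs k f2 -> recs k f3 -> recs k (fun s => g (f1 s) (f2 s) (f3 s)).

Lemma R1P g : recs 1 (fun s => g (nth 0 s 0)) -> R1 g.
Proof. by move=> Hg k f Hf; apply: (@recs_comp k _ [:: f] Hg); case. Qed.

Lemma R2P g : recs 2 (fun s => g (nth 0 s 0) (nth 0 s 1)) -> R2 g.
Proof.
by move=> Hg k f1 f2 H1 H2; apply: (@recs_comp k _ [:: f1; f2] Hg) => -[|[]].
Qed.

Lemma R3P g : recs 3 (fun s => g (nth 0 s 0) (nth 0 s 1) (nth 0 s 2)) -> R3 g.
Proof.
move=> Hg k f1 f2 f3 H1 H2 H3.
by apply: (@recs_comp k _ [:: f1; f2; f3] Hg) => -[|[|[]]].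
Qed.

Lemma R1_succ : R1 succn.
Proof.
apply: R1P; apply: rec_succ => t.
by rewrite /thead (tnth_nth 0).
Qed.

Lemma recs_const k c : recs k (fun=> c).
Proof. by elim: c => [|c IH]; [exact: recs_zero | exact: R1_succ]. Qed.

Lemma recs_weak k f : recs k f -> recs k.+1 (fun s => f (behead s)).
Proof.
move=> Hf; set fs := [seq (fun s => nth 0 s i.+1) | i <- iota 0 k].
have sfs : size fs = k by rewrite /= size_map size_iota.
apply: (@recs_ext _ (fun s => f [seq h s | h <- fs])).
  apply: recs_comp; first by rewrite sfs.
  move=> i; rewrite sfs => ik.
  by rewrite (nth_map 0) ?size_iota // nth_iota //; exact: recs_var.
case=> [|x s] //= [ss]; congr f; rewrite /= -map_comp.
by apply: (@eq_from_nth _ 0) => [|i]; rewrite size_map size_iota // => ik;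
  rewrite (nth_map 0) ?size_iota // nth_iota.
Qed.

Lemma recs_nth_behead k (g : seq nat -> seq nat) i :
  recs k (fun s => nth 0 (g s) i.+1) -> recs k (fun s => nth 0 (behead (g s)) i).
Proof. by move=> H; apply: recs_ext H _ => s _; rewrite nth_behead. Qed.

Lemma recs_prim k (g h : seq nat -> nat) (F : nat -> seq nat -> nat) :
  recs k g -> recs k.+2 h ->
  (forall s, F 0 s = g s) ->
  (forall x s, F x.+1 s = h [:: x, F x s & s]) ->
  recs k.+1 (fun s => F (nth 0 s 0) (behead s)).
Proof.
move=> Hg Hh F0 FS.
by apply: (@rec_prim k _ _ (fun t => F (nth 0 t 0) (behead t)) Hg Hh) => /=.
Qed.

Lemma recs_min k (B : seq nat -> nat) (P : nat -> seq nat -> bool) :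
  recs k B -> recs k.+1 (fun s => P (nth 0 s 0) (behead s)) ->
  (forall s, P (B s) s) -> recs k (fun s => find (P^~ s) (iota 0 (B s).+1)).
Proof.
have H (b : nat) (Q : pred nat) : Q b -> [/\ Q (find Q (iota 0 b.+1)) &
   forall y, y < find Q (iota 0 b.+1) -> Q y = false].
  move=> Qb; have hq : has Q (iota 0 b.+1).
    by apply/hasP; exists b; rewrite // mem_iota add0n ltnSn.
  have fb : find Q (iota 0 b.+1) < b.+1 by move: hq; rewrite has_find size_iota.
  split; first by have := nth_find 0 hq; rewrite nth_iota.
  move=> y yf; have := before_find 0 yf; rewrite nth_iota //.
  exact: ltn_trans yf fb.
(* Minimisation looks for a zero, whereas [P] is to become true; hence the negation. *)
have Rsubn1 : R1 (fun x => x == 0).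
  apply: R1P; apply: (@recs_ext 1 (fun s => (fun x (_ : seq nat) =>
    if x is _.+1 then 0 else 1) (nth 0 s 0) (behead s))).
    apply: (@recs_prim 0 (fun=> 1) (fun=> 0) (fun x _ => if x is _.+1 then 0 else 1));
      by [exact: recs_const|].
  by move=> s _; case: (nth 0 s 0).
move=> HB HP PB; 
apply: (@rec_min k _ (fun t => find (P^~ t) (iota 0 (B t).+1)) (Rsubn1 _ _ HP)).
  move=> t /=.
  by have [-> _] := H _ (P^~ t) (PB t).
move=> t y yf /=; by have [_ /(_ y yf) ->] := H _ (P^~ t) (PB t).
Qed.

(** A hook that [rec_tac] calls on shapes it does not know; it is rebound each time further
    functions are shown to be recursive. *)
Ltac rec_hint := fail.
Ltac rec_tac := cbv beta; solve [assumption] || lazymatch goal with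
  | |- recs _ (fun _ => ?c) => exact: recs_const
  | |- recs _ (fun s => nth 0 s _) => by apply: recs_var
  | |- recs ?k (fun s => nth 0 (behead (@?g s)) ?i) =>
      refine (@recs_nth_behead k g i _); rec_tac
  | |- recs _ (fun s => succn _) => apply: R1_succ; rec_tac
  | |- _ => rec_hint
  end.

(** * Arithmetic, Boolean connectives and bounded search *)

Lemma R1_pred : R1 predn.
Proof.
apply: R1P.
apply: (@recs_prim 0 (fun=> 0) (nth 0 ^~ 0) (fun x _ => x.-1)) => //; rec_tac.
Qed.

Lemma R2_iter g a : R1 g -> R1 a -> R2 (fun x y => iter x g (a y)).
Proof.
move=> Hg Ha; apply: R2P; apply: (@recs_ext 2
  (fun s => (fun x s => iter x g (a (nth 0 s 0))) (nth 0 s 0) (behead s))); last first.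
  by move=> s _; rewrite nth_behead.
apply: (@recs_prim 1 (fun s => a (nth 0 s 0)) (fun s => g (nth 0 s 1))
  (fun x s => iter x g (a (nth 0 s 0)))) => //.
  by apply: Ha; rec_tac.
by apply: Hg; rec_tac.
Qed.

Lemma R1_id : R1 id.
Proof. by []. Qed.

Lemma R2_addn : R2 addn.
Proof.
move=> k f1 f2 H1 H2; apply: recs_ext (R2_iter R1_succ R1_id H1 H2) _.
by move=> s _; elim: (f1 s) => //= x ->.
Qed.

Lemma R2_subn : R2 subn.
Proof.
move=> k f1 f2 H1 H2; apply: recs_ext (R2_iter R1_pred R1_id H2 H1) _.
by move=> s _; elim: (f2 s) => [|x IH] /=; rewrite ?subn0 // IH subnS.
Qed.

Ltac rec_arith0 := lazymatch goal with
  | |- recs _ (fun s => predn _) => apply: R1_pred; rec_tac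
  | |- recs _ (fun s => addn _ _) => apply: R2_addn; rec_tac
  | |- recs _ (fun s => subn _ _) => apply: R2_subn; rec_tac
  end.
Ltac rec_hint ::= rec_arith0.

Lemma R2_muln : R2 muln.
Proof.
apply: R2P; apply: (@recs_ext 2
  (fun s => (fun x s => x * nth 0 s 0) (nth 0 s 0) (behead s))); last first.
  by move=> s _; rewrite nth_behead.
apply: (@recs_prim 1 (fun=> 0) (fun s => nth 0 s 2 + nth 0 s 1)
  (fun x s => x * nth 0 s 0)) => //; rec_tac.
Qed.

Ltac rec_arith1 := lazymatch goal with
  | |- recs _ (fun s => muln _ _) => apply: R2_muln; rec_tac
  | |- _ => rec_arith0
  end.
Ltac rec_hint ::= rec_arith1.

Lemma R2_expn : R2 expn.
Proof.
move=> k f1 f2 H1 H2.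
suff H : R2 (fun x y => y ^ x) by exact: (H k f2 f1).
apply: R2P; apply: (@recs_ext 2
  (fun s => (fun x s => nth 0 s 0 ^ x) (nth 0 s 0) (behead s))); last first.
  by move=> s _; rewrite nth_behead.
apply: (@recs_prim 1 (fun=> 1) (fun s => nth 0 s 2 * nth 0 s 1)
  (fun x s => nth 0 s 0 ^ x)); [rec_tac|rec_tac|by []|].
by move=> x s /=; rewrite expnS.
Qed.

Lemma recs_eq0 k f : recs k f -> recs k (fun s => f s == 0).
Proof.
move=> Hf; apply: (@recs_ext _ (fun s => 1 - f s)); first by rec_tac.
by move=> s _; case: (f s) => // -[].
Qed.

Lemma recs_leq k f g : recs k f -> recs k g -> recs k (fun s => f s <= g s).
Proof. by move=> Hf Hg; rewrite /leq; apply: recs_eq0; rec_tac. Qed.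

Lemma recs_not k (b : seq nat -> bool) :
  recs k (fun s => b s) -> recs k (fun s => ~~ b s).
Proof.
move=> Hb; apply: (@recs_ext _ (fun s => 1 - b s)); first by rec_tac.
by move=> s _; case: (b s).
Qed.

Lemma recs_and k (b c : seq nat -> bool) :
  recs k (fun s => b s) -> recs k (fun s => c s) -> recs k (fun s => b s && c s).
Proof.
move=> Hb Hc; apply: (@recs_ext _ (fun s => b s * c s)); first by rec_tac.
by move=> s _; case: (b s); case: (c s).
Qed.

Lemma recs_or k (b c : seq nat -> bool) :
  recs k (fun s => b s) -> recs k (fun s => c s) -> recs k (fun s => b s || c s).
Proof.
move=> Hb Hc; apply: (@recs_ext _ (fun s => ~~ (~~ b s && ~~ c s))).
  by apply: recs_not; apply: recs_and; apply: recs_not.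
by move=> s _; case: (b s); case: (c s).
Qed.

Lemma recs_imp k (b c : seq nat -> bool) :
  recs k (fun s => b s) -> recs k (fun s => c s) -> recs k (fun s => b s ==> c s).
Proof.
move=> Hb Hc; apply: (@recs_ext _ (fun s => ~~ b s || c s)).
  by apply: recs_or => //; apply: recs_not.
by move=> s _; case: (b s); case: (c s).
Qed.

Lemma recs_eq k f g : recs k f -> recs k g -> recs k (fun s => f s == g s).
Proof.
move=> Hf Hg; apply: (@recs_ext _ (fun s => (f s <= g s) && (g s <= f s))).
  by apply: recs_and; apply: recs_leq.
by move=> s _; rewrite eqn_leq.
Qed.

Lemma recs_if k (b : seq nat -> bool) f g :
  recs k (fun s => b s) -> recs k f -> recs k g ->
  recs k (fun s => if b s then f s else g s).
Proof.
move=> Hb Hf Hg; apply: (@recs_ext _ (fun s => b s * f s + (1 - b s) * g s)).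
  by rec_tac.
by move=> s _; case: (b s); rewrite ?mul1n ?addn0.
Qed.

(** Adding the alternative [B s <= y] makes the minimisation succeed at [B s] at the latest, which
    is also the value of [find] when nothing is found. *)
Lemma recs_find k (B : seq nat -> nat) (P : nat -> seq nat -> bool) :
  recs k B -> recs k.+1 (fun s => P (nth 0 s 0) (behead s)) ->
  recs k (fun s => find (P^~ s) (iota 0 (B s))).
Proof.
move=> HB HP.
pose Q y s := P y s || (B s <= y).
apply: (@recs_ext _ (fun s => find (Q^~ s) (iota 0 (B s).+1))).
  apply: recs_min => //; last by move=> s; rewrite /Q leqnn orbT.
  apply: recs_or => //; apply: recs_leq; last by apply: recs_var.
  exact: recs_weak.
move=> s _; rewrite -addn1 iotaD add0n find_cat size_iota.
have E : {in iota 0 (B s), Q^~ s =1 P^~ s}.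
  by move=> y; rewrite mem_iota add0n => /= yB; rewrite /Q [B s <= y]leqNgt yB orbF.
rewrite (eq_in_has E) (eq_in_find E) /= /Q leqnn orbT addn0.
by case: ifP => // /negbT; rewrite has_find size_iota -leqNgt => h;
  apply/eqP; rewrite eqn_leq h -[X in _ <= X](size_iota 0) find_size.
Qed.

Lemma recs_has k (B : seq nat -> nat) (P : nat -> seq nat -> bool) :
  recs k B -> recs k.+1 (fun s => P (nth 0 s 0) (behead s)) ->
  recs k (fun s => has (P^~ s) (iota 0 (B s))).
Proof.
move=> HB HP.
apply: (@recs_ext _ (fun s => find (P^~ s) (iota 0 (B s)) < B s)).
  by apply: recs_leq => //; apply: R1_succ; apply: recs_find.
by move=> s _; rewrite has_find size_iota.
Qed.

Lemma recs_all k (B : seq nat -> nat) (P : nat -> seq nat -> bool) :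
  recs k B -> recs k.+1 (fun s => P (nth 0 s 0) (behead s)) ->
  recs k (fun s => all (P^~ s) (iota 0 (B s))).
Proof.
move=> HB HP.
apply: (@recs_ext _ (fun s => ~~ has (fun y => ~~ P y s) (iota 0 (B s)))).
  apply: recs_not; apply: (@recs_has k B (fun y s => ~~ P y s)) => //.
  exact: recs_not.
by move=> s _; rewrite -all_predC; congr nat_of_bool; apply: eq_all => y /=;
  rewrite negbK.
Qed.

Ltac rec_bool := lazymatch goal with
  | |- recs _ (fun s => expn _ _) => apply: R2_expn; rec_tac
  | |- recs _ (fun s => nat_of_bool (negb _)) => apply: recs_not; rec_tac
  | |- recs _ (fun s => nat_of_bool (andb _ _)) => apply: recs_and; rec_tac
  | |- recs _ (fun s => nat_of_bool (orb _ _)) => apply: recs_or; rec_tac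
  | |- recs _ (fun s => nat_of_bool (implb _ _)) => apply: recs_imp; rec_tac
  | |- recs _ (fun s => nat_of_bool (eq_op _ _)) => apply: recs_eq; rec_tac
  | |- recs _ (fun s => nat_of_bool (leq _ _)) => apply: recs_leq; rec_tac
  | |- recs _ (fun s => if _ then _ else _) => apply: recs_if; rec_tac
  | |- recs ?k (fun s => find (@?P s) (iota 0 (@?B s))) =>
      let Q := eval cbv beta in (fun y s => P s y) in
      refine (@recs_find k B Q _ _); rec_tac
  | |- recs ?k (fun s => nat_of_bool (has (@?P s) (iota 0 (@?B s)))) =>
      let Q := eval cbv beta in (fun y s => P s y) in
      refine (@recs_has k B Q _ _); rec_tac
  | |- recs ?k (fun s => nat_of_bool (all (@?P s) (iota 0 (@?B s)))) =>
      let Q := eval cbv beta in (fun y s => P s y) in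
      refine (@recs_all k B Q _ _); rec_tac
  | |- _ => rec_arith1
  end.
Ltac rec_hint ::= rec_bool.

Lemma R2_divn : R2 divn.
Proof.
apply: R2P; apply: (@recs_ext 2 (fun s => if nth 0 s 1 == 0 then 0 else
  find (fun q => nth 0 s 0 < q.+1 * nth 0 s 1) (iota 0 (nth 0 s 0).+1))).
  rec_tac.
move=> s _; move: (nth 0 s 0) (nth 0 s 1) => m [|d] //.
rewrite [_ == 0]/=; set P := fun q => m < _.
have Pq q : P q = (m %/ d.+1 <= q) by rewrite /P -ltn_divLR.
have Pm : has P (iota 0 m.+1).
  by apply/hasP; exists m; rewrite ?Pq ?leq_div // mem_iota add0n ltnSn.
have fm : find P (iota 0 m.+1) < m.+1 by move: Pm; rewrite has_find size_iota.
apply/eqP; rewrite eqn_leq; apply/andP; split; last first.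
  by have := nth_find 0 Pm; rewrite nth_iota // Pq.
rewrite leqNgt; apply/negP => /(before_find 0).
by rewrite nth_iota ?Pq ?leqnn // ltnS leq_div.
Qed.

Lemma R2_modn : R2 modn.
Proof.
move=> k f1 f2 H1 H2; apply: (@recs_ext _ (fun s => f1 s - f1 s %/ f2 s * f2 s)).
  by apply: R2_subn => //; apply: R2_muln => //; apply: R2_divn.
by move=> s _; rewrite {1}(divn_eq (f1 s) (f2 s)) addKn.
Qed.

(** * Cantor pairs and course-of-values recursion *)

Lemma R2_cantor : R2 cantor.
Proof.
have H : R1 (fun x => 'C(x, 2)).
  apply: R1P; apply: (@recs_prim 0 (fun=> 0) (fun s => nth 0 s 0 + nth 0 s 1)
    (fun x _ => 'C(x, 2))) => //; try rec_tac.
  by move=> x s; rewrite binS bin1 addnC.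
move=> k f1 f2 H1 H2; rewrite /cantor; apply: R2_addn => //; apply: H; rec_tac.
Qed.

(** A search up to [z] is enough, because neither coordinate of a pair exceeds its code. *)
Definition cfst z := find (fun x => has (fun y => cantor x y == z) (iota 0 z.+1))
  (iota 0 z.+1).
Definition csnd z := find (fun y => has (fun x => cantor x y == z) (iota 0 z.+1))
  (iota 0 z.+1).

(** The codes on the diagonal of sum [s] start at ['C(s.+1, 2)] and stay below ['C(s.+2, 2)], so a
    code determines its diagonal and then the second coordinate. *)
Lemma cantor_inj x y x' y' : cantor x y = cantor x' y' -> x = x' /\ y = y'.
Proof.
have mono a b : a <= b -> 'C(a.+1, 2) <= 'C(b.+1, 2) by move=> ab; apply: leq_bin2l.
have step a : 'C(a.+2, 2) = 'C(a.+1, 2) + a.+1 by rewrite binS bin1.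
have lt u v u' v' : cantor u v = cantor u' v' -> u + v < u' + v' -> False.
  rewrite /cantor => E uv; have := mono _ _ uv; rewrite step; lia.
move=> E; have [/lt []//|/lt []//|e] := ltngtP (x + y) (x' + y').
by move: E; rewrite /cantor e => /addnI; lia.
Qed.

Lemma leq_cantor_l x y : x <= cantor x y.
Proof.
apply: leq_trans (leq_addr _ _); apply: leq_trans (leq_addr y x) _.
by rewrite binS bin1 leq_addl.
Qed.

Lemma leq_cantor_r x y : y <= cantor x y.
Proof. exact: leq_addl. Qed.

(** Makes the codes of proper subterms and subformulas strictly smaller: the tag 0 occurs only at
    [TVar] and [FEq], where neither recursion calls itself. *)
Lemma ltn_cantor_r x y : 0 < x -> y < cantor x y.
Proof. by move=> x0; rewrite /cantor -[X in X < _]add0n ltn_add2r bin_gt0; lia. Qed.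

Lemma find_iota_eq (P : pred nat) b x :
  x < b -> (forall y, P y = (y == x)) -> find P (iota 0 b) = x.
Proof.
move=> xb Px; have hP : has P (iota 0 b).
  by apply/hasP; exists x; rewrite ?Px // mem_iota add0n.
have fb : find P (iota 0 b) < b by move: hP; rewrite has_find size_iota.
by have := nth_find 0 hP; rewrite nth_iota // Px => /eqP.
Qed.

Lemma cfstK x y : cfst (cantor x y) = x.
Proof.
apply: find_iota_eq => [|z]; first by rewrite ltnS leq_cantor_l.
apply/hasP/eqP => [[w _ /eqP /cantor_inj[]] //|->].
by exists y; rewrite // mem_iota add0n ltnS leq_cantor_r.
Qed.

Lemma csndK x y : csnd (cantor x y) = y.
Proof.
apply: find_iota_eq => [|z]; first by rewrite ltnS leq_cantor_r.
apply/hasP/eqP => [[w _ /eqP /cantor_inj[]] //|->].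
by exists x; rewrite // mem_iota add0n ltnS leq_cantor_l.
Qed.

Ltac rec_cantor := lazymatch goal with
  | |- recs _ (fun s => divn _ _) => apply: R2_divn; rec_tac
  | |- recs _ (fun s => modn _ _) => apply: R2_modn; rec_tac
  | |- recs _ (fun s => cantor _ _) => apply: R2_cantor; rec_tac
  | |- _ => rec_bool
  end.
Ltac rec_hint ::= rec_cantor.

Lemma R1_cfst : R1 cfst.
Proof. by apply: R1P; rewrite /cfst; rec_tac. Qed.

Lemma R1_csnd : R1 csnd.
Proof. by apply: R1P; rewrite /csnd; rec_tac. Qed.

Ltac rec_unpair := lazymatch goal with
  | |- recs _ (fun s => cfst _) => apply: R1_cfst; rec_tac
  | |- recs _ (fun s => csnd _) => apply: R1_csnd; rec_tac
  | |- _ => rec_cantor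
  end.
Ltac rec_hint ::= rec_unpair.

(* The values before [z], most recent first, as nested Cantor pairs. *)
Fixpoint hist (H : nat -> nat -> seq nat -> nat) (p : seq nat) (z : nat) : nat :=
  if z is z'.+1 then cantor (H z' (hist H p z') p) (hist H p z') else 0.

Definition cov H p z := H z (hist H p z) p.

(** The entry of [x] lies beneath the [z - x.+1] entries that were added after it. *)
Definition get h z x := cfst (iter (z - x.+1) csnd h).

Lemma get_hist H p z x : x < z -> get (hist H p z) z x = cov H p x.
Proof.
rewrite /get; elim: z => // z IH; rewrite ltnS leq_eqVlt => /orP[/eqP ->|xz].
  by rewrite subnn /= cfstK.
by rewrite subSn // iterSr /= csndK -IH.
Qed.

Lemma R3_get : R3 get.
Proof.
move=> k f1 f2 f3 H1 H2 H3; apply: R1_cfst.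
have := @R2_iter _ id R1_csnd R1_id; apply => //.
by apply: R2_subn => //; apply: R1_succ.
Qed.

Lemma recs_subst_head k (G : nat -> seq nat -> nat) f :
  recs k.+1 (fun s => G (nth 0 s 0) (behead s)) -> recs k.+1 f ->
  recs k.+1 (fun s => G (f s) (behead s)).
Proof.
move=> HG Hf; set fs := f :: [seq (fun s => nth 0 s i.+1) | i <- iota 0 k].
have sfs : size fs = k.+1 by rewrite /= size_map size_iota.
apply: (@recs_ext _ (fun s => (fun s => G (nth 0 s 0) (behead s)) [seq h s | h <- fs])).
  apply: (@recs_comp _ (fun s => G (nth 0 s 0) (behead s))); first by rewrite sfs.
  case=> [|i] //; rewrite sfs ltnS => ik /=.
  by rewrite (nth_map 0) ?size_iota // nth_iota //; exact: recs_var.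
case=> [|x s] //= [ss]; congr G; rewrite /= -map_comp.
by apply: (@eq_from_nth _ 0) => [|i]; rewrite size_map size_iota // => ik;
  rewrite (nth_map 0) ?size_iota // nth_iota.
Qed.

(** The history obeys a plain primitive recursion, and the value at [z] is the head of the history
    of [z.+1]. *)
Lemma recs_cov k H : recs k.+2 (fun s => H (nth 0 s 0) (nth 0 s 1) (behead (behead s))) ->
  recs k.+1 (fun s => cov H (behead s) (nth 0 s 0)).
Proof.
move=> HH.
have Hh : recs k.+1 (fun s => hist H (behead s) (nth 0 s 0)).
  apply: (@recs_prim k (fun=> 0) (fun s => cantor (H (nth 0 s 0) (nth 0 s 1)
    (behead (behead s))) (nth 0 s 1)) (fun z p => hist H p z)) => //.
    by rec_tac.
  by apply: R2_cantor => //; apply: recs_var.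
apply: (@recs_ext _ (fun s => cfst (hist H (behead s) (nth 0 s 0).+1))).
  apply: R1_cfst; apply: (recs_subst_head (G := fun z p => hist H p z)) => //.
  by rec_tac.
by move=> s _; rewrite /= cfstK.
Qed.

Lemma recs_sum k n (F : 'I_n -> seq nat -> nat) :
  (forall j, recs k (F j)) -> recs k (fun s => \sum_(j < n) F j s).
Proof.
elim: n F => [|n IH] F HF.
  by apply: (@recs_ext _ (fun=> 0)); [rec_tac | move=> s _; rewrite big_ord0].
apply: (@recs_ext _ (fun s => F ord0 s + \sum_(j < n) F (lift ord0 j) s)).
  by apply: R2_addn => //; apply: IH.
by move=> s _; rewrite big_ord_recl.
Qed.

Lemma R1_table n (g : nat -> nat) : R1 (fun z => if z < n then g z else 0).
Proof.
apply: R1P; apply: (@recs_ext _ (fun s => \sum_(j < n) (nth 0 s 0 == j) * g j)).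
  by apply: recs_sum => j; rec_tac.
move=> s _; case: ifP => [zn|/negbT zn].
  rewrite (bigD1 (Ordinal zn)) //= eqxx mul1n big1 ?addn0 // => j.
  by rewrite -val_eqE /= eq_sym => /negbTE ->.
rewrite big1 // => j _; case: eqP => // e.
by move: zn; rewrite e ltn_ord.
Qed.

(** Coefficients may be negative, so they are split into positive and negative parts; the truncated
    difference of the two sums is exact because the result is a value of [U]. *)
Lemma R1_linear_recurrence (U : nat -> nat) k (a : 'I_k -> int) :
  linear_recurrence U a -> R1 U.
Proof.
move=> rU.
pose ap j := if a j is Posz n then n else 0.
pose an j := if a j is Negz n then n.+1 else 0.
have aE j : (a j = (ap j)%:Z - (an j)%:Z)%R.
  by rewrite /ap /an; case: (a j) => n; lia.
(* The initial values are a finite table. The inner test gives them the shape required by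
   [R1_table], as [U] itself is not yet known to be recursive. *)
pose H z h (_ : seq nat) := if z < k then (if z < k then U z else 0) else
  \sum_(j < k) ap j * get h z (z - k + j) - \sum_(j < k) an j * get h z (z - k + j).
have UE z : U z = cov H [::] z.
  elim/ltn_ind: z => z IH; rewrite /cov {1}/H.
  case: ltnP => // kz; rewrite -{1}(subnK kz).
  have E (b : 'I_k -> nat) : \sum_(j < k) b j * get (hist H [::] z) z (z - k + j) =
      \sum_(j < k) b j * U (z - k + j).
    apply: eq_bigr => j _; have jz : z - k + j < z by have := ltn_ord j; lia.
    by rewrite get_hist // -IH.
  rewrite !E; set S1 := \sum_(j < k) ap _ * _; set S2 := \sum_(j < k) an _ * _.
  suff : ((U (z - k + k)%N)%:Z = S1%:Z - S2%:Z)%R by lia.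
  rewrite rU /S1 /S2 !(big_morph Posz PoszD (erefl _)) -sumrB.
  by apply: eq_bigr => j _; rewrite aE mulrBl !PoszM.
apply: R1P; apply: (@recs_ext _ (fun s => cov H (behead s) (nth 0 s 0))).
  apply: recs_cov; rewrite /H; apply: recs_if; first by rec_tac.
    by apply: (@R1_table k U); rec_tac.
  by apply: R2_subn; apply: recs_sum => j; apply: R2_muln; first [rec_tac |
    apply: R3_get; rec_tac].
by move=> [|z []] //= _; rewrite UE.
Qed.

(** * The function [V U] is recursive *)

Section RecursiveV.
Variable U : nat -> nat.
Hypotheses (U0 : U 0 = 1) (Uinc : forall i, U i < U i.+1).

Lemma ltn_U i : i < U i.
Proof. by elim: i => [|i IH]; [rewrite U0 | exact: leq_ltn_trans (Uinc i)]. Qed.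

Lemma U_gt0 i : 0 < U i.
Proof. exact: leq_ltn_trans (ltn_U i). Qed.

Lemma leq_U i j : i <= j -> U i <= U j.
Proof.
elim: j => [|j IH]; rewrite leq_eqVlt => /orP[/eqP->|] // ij.
exact: leq_trans (IH ij) (ltnW (Uinc j)).
Qed.

Lemma has_greedy_digits k m : m < U k ->
  has (fun c => c != 0) (greedy_digits U k m) = (m != 0).
Proof.
move=> mk; have [Em _] := greedy_digitsP U0 Uinc mk.
apply/idP/idP => [/hasP[d dg d0]|m0].
  apply/eqP => m0; move: dg; rewrite m0.
  suff : all (pred1 0) (greedy_digits U k 0) by move/allP => H /H; apply/negP.
  elim: k {mk Em} => //= k IH; rewrite mod0n div0n all_rcons /= IH.
  by [].
apply/negPn/negP; rewrite -all_predC => /allP H; case/eqP: m0.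
rewrite Em big1 // => j _.
have := H (nth 0 (greedy_digits U k m) j); rewrite mem_nth ?size_greedy_digits //=.
by move=> /(_ isT) /negPn/eqP ->.
Qed.

(** Expansions start with the least significant digit, so a longer one only has more zeros at its
    end, after the digit that [find] returns. *)
Lemma V_low L m : 0 < m -> m < U L ->
  V U m = U (find (fun c => c != 0) (greedy_digits U L m)).
Proof.
move=> m0 mL; rewrite /V gtn_eqF //; congr U.
rewrite /rep; set p := fun k => m < U k; set k := find p _.
have hp : has p (iota 0 m.+1).
  by apply/hasP; exists m; rewrite ?mem_iota ?add0n //= /p ltn_U.
have km : k < m.+1 by move: hp; rewrite has_find size_iota.
have mk : m < U k by have := nth_find 0 hp; rewrite -/k nth_iota.
have kL : k <= L.
  rewrite leqNgt; apply/negP => Lk; have := before_find 0 Lk.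
  by rewrite nth_iota ?add0n /p ?mL // (ltn_trans Lk).
rewrite -(subnKC kL); elim: (L - k) => [|j IH]; first by rewrite addn0.
have mj : m < U (k + j) by apply: leq_trans mk (leq_U (leq_addr _ _)).
by rewrite addnS /= modn_small // -cats1 find_cat has_greedy_digits // -lt0n m0.
Qed.

Lemma V_step L m : 0 < m -> m < U L.+1 ->
  V U m = if m %% U L == 0 then U L else V U (m %% U L).
Proof.
move=> m0 mL; rewrite (V_low m0 mL) /= -cats1 find_cat.
have mu : m %% U L < U L by rewrite ltn_pmod ?U_gt0.
rewrite has_greedy_digits // size_greedy_digits /=.
have [r0|r0] := eqVneq (m %% U L) 0; last by rewrite (V_low _ mu) // lt0n.
suff -> : m %/ U L != 0 by rewrite addn0.
by apply/eqP => d0; move: m0; rewrite (divn_eq m (U L)) r0 d0.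
Qed.

(** With [U i <= m < U i.+1], the remainder of [m] modulo [U i] is smaller than [m], so [V_step]
    becomes a course-of-values recursion. *)
Lemma R1_V : R1 U -> R1 (V U).
Proof.
move=> RU.
pose H m h (_ : seq nat) := if m == 0 then 1 else
  (fun i => if m %% U i == 0 then U i else get h m (m %% U i))
  (find (fun i => m < U i.+1) (iota 0 m.+1)).
have VE m : V U m = cov H [::] m.
  elim/ltn_ind: m => m IH; rewrite /cov {1}/H.
  case: eqP => [-> //|/eqP m0]; set p := fun i => m < _; set i := find p _.
  have hp : has p (iota 0 m.+1).
    apply/hasP; exists m; rewrite ?mem_iota ?add0n //= /p.
    exact: ltn_trans (ltn_U m) (Uinc m).
  have im : i < m.+1 by move: hp; rewrite has_find size_iota.
  have mi : m < U i.+1 by have := nth_find 0 hp; rewrite -/i nth_iota.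
  have im' : U i <= m.
    case E: i => [|j]; first by rewrite U0 lt0n.
    have ji : j < i by rewrite E.
    have := before_find 0 ji; rewrite nth_iota ?add0n /p; last exact: ltn_trans ji im.
    by move/negbT; rewrite -leqNgt.
  rewrite (V_step _ mi) ?lt0n //; case: eqP => // r0.
  have rm : m %% U i < m by apply: leq_trans im'; rewrite ltn_pmod ?U_gt0.
  by rewrite get_hist // -IH.
have Rf : R1 (fun m => find (fun i => m < U i.+1) (iota 0 m.+1)).
  apply: R1P; refine (@recs_find 1 _ (fun i s => nth 0 s 0 < U i.+1) _ _).
    by rec_tac.
  by apply: recs_leq; [rec_tac | apply: RU; rec_tac].
apply: R1P; apply: (@recs_ext _ (fun s => cov H (behead s) (nth 0 s 0))).
  apply: recs_cov; rewrite /H.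
  have Hf : recs 2 (fun s => find (fun i => nth 0 s 0 < U i.+1) (iota 0 (nth 0 s 0).+1)).
    by apply: Rf; rec_tac.
  have HU := RU _ _ Hf.
  have Hm := R2_modn (recs_var (isT : 0 < 2)) HU.
  apply: recs_if; [by rec_tac|by rec_tac|].
  apply: recs_if; [by apply: recs_eq; rec_tac| by []|].
  by apply: R3_get; rec_tac.
by move=> [|z []] //= _; rewrite VE.
Qed.

End RecursiveV.

(** * Bounded evaluation of formulas *)

(** A valuation with values below [B] is coded as one number [v], whose digits in base [B] are the
    values of the variables. *)
Definition lookup (B v y : nat) : nat := v %/ B ^ y %% B.

Lemma lookup_surj B n (w : nat -> nat) : (forall y, w y < B) ->
  exists2 v, v < B ^ n & forall y, lookup B v y = if y < n then w y else 0.
Proof.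
move=> wB; have B0 : 0 < B by exact: leq_ltn_trans (wB 0).
elim: n w wB => [|n IH] w wB.
  by exists 0 => // y; rewrite /lookup div0n mod0n.
have [v vn vE] := IH (w \o succn) (fun y => wB y.+1).
exists (w 0 + v * B).
  rewrite expnS (leq_trans (_ : _ < v.+1 * B)) //.
    by rewrite mulSn ltn_add2r.
  by rewrite mulnC leq_mul2l vn orbT.
case=> [|y]; rewrite /lookup; first by rewrite divn1 addnC modnMDl modn_small.
by rewrite expnS divnMA addnC divnMDl // (divn_small (wB 0)) addn0 -/(lookup B v y) vE.
Qed.

Lemma lookup_out B v n y : 0 < B -> v < B ^ n -> n <= y -> lookup B v y = 0.
Proof.
move=> B0 vn ny; rewrite /lookup divn_small ?mod0n //.
by rewrite (leq_trans vn) // leq_pexp2l.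
Qed.

Arguments cantor : simpl never.
Arguments cfst : simpl never.
Arguments csnd : simpl never.
Arguments hist : simpl never.
Arguments cov : simpl never.
Arguments get : simpl never.

Section Evaluator.
Variable U : nat -> nat.

Definition term_step (c h : nat) (p : seq nat) : nat :=
  if cfst c == 0 then lookup (nth 0 p 1) (nth 0 p 0) (csnd c)
  else if cfst c == 1 then get h c (cfst (csnd c)) + get h c (csnd (csnd c))
  else V U (get h c (csnd c)).

Definition term_val (c v B : nat) : nat := cov term_step [:: v; B] c.

Lemma term_valE t v B : term_val (code_term t) v B = eval U (lookup B v) t.
Proof.
elim: t => [x|t1 IH1 t2 IH2|t IH] /=; rewrite /term_val /cov {1}/term_step !cfstK !csndK //=.
  have h : cantor (code_term t1) (code_term t2) <
           cantor 1 (cantor (code_term t1) (code_term t2)) by exact: ltn_cantor_r.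
  rewrite cfstK !get_hist; first by rewrite -!/(term_val _ v B) IH1 IH2.
    by apply: leq_ltn_trans h; exact: leq_cantor_r.
  by apply: leq_ltn_trans h; exact: leq_cantor_l.
by rewrite get_hist ?ltn_cantor_r // -/(term_val _ v B) IH.
Qed.

(* [C] is the code of the whole formula and [lev C T c] the length up to which a
   variable quantified in front of the subformula with code [c] has to be
   searched; it grows as one enters subformulas, whose codes decrease. *)
Definition lev (C T c : nat) : nat := (C - c) * T.

Definition agree (C B x v v' : nat) : bool :=
  all (fun y => (y == x) || (lookup B v y == lookup B v' y)) (iota 0 C.+1).

Definition admissible (C T B x c v v' : nat) : bool :=
  agree C B x v v' && (lookup B v' x < U (lev C T c)).

Definition sub_val (h z W c v : nat) : bool := get h z (c * W + v) == 1.

Definition formula_step_at (C T B W z h c v : nat) : nat :=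
  if cfst c == 0 then
    nat_of_bool (term_val (cfst (csnd c)) v B == term_val (csnd (csnd c)) v B)
  else if cfst c == 1 then nat_of_bool (~~ sub_val h z W (csnd c) v)
  else if cfst c == 2 then
    nat_of_bool (sub_val h z W (cfst (csnd c)) v && sub_val h z W (csnd (csnd c)) v)
  else if cfst c == 3 then
    nat_of_bool (sub_val h z W (cfst (csnd c)) v || sub_val h z W (csnd (csnd c)) v)
  else if cfst c == 4 then
    nat_of_bool (sub_val h z W (cfst (csnd c)) v ==> sub_val h z W (csnd (csnd c)) v)
  else if cfst c == 5 then
    nat_of_bool (has (fun v' => admissible C T B (cfst (csnd c)) (csnd (csnd c)) v v' &&
                    sub_val h z W (csnd (csnd c)) v') (iota 0 W))
  else
    nat_of_bool (all (fun v' => admissible C T B (cfst (csnd c)) (csnd (csnd c)) v v' ==>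
                    sub_val h z W (csnd (csnd c)) v') (iota 0 W)).

Definition formula_step (z h : nat) (p : seq nat) : nat :=
  (fun C T B => formula_step_at C T B (B ^ C.+1) z h (z %/ B ^ C.+1) (z %% B ^ C.+1))
    (nth 0 p 0) (nth 0 p 1) (nth 0 p 2).

(** For [v < B ^ C.+1] the argument of [cov] orders the pairs of [c] and [v] lexicographically;
    hence the values at smaller codes are available under all valuations, as quantifiers require. *)
Definition formula_val (C T B c v : nat) : nat :=
  cov formula_step [:: C; T; B] (c * B ^ C.+1 + v).

Lemma R3_lookup : R3 lookup.
Proof. by apply: R3P; rewrite /lookup; rec_tac. Qed.

Lemma R3_term_val : R1 (V U) -> R3 term_val.
Proof.
move=> RV; apply: R3P.
apply: (@recs_ext _ (fun s => cov term_step (behead s) (nth 0 s 0))); last first.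
  by move=> [|x [|y [|z []]]].
apply: recs_cov; rewrite /term_step.
apply: recs_if; first by rec_tac.
  by apply: R3_lookup; rec_tac.
apply: recs_if; first by rec_tac.
  by apply: R2_addn; apply: R3_get; rec_tac.
by apply: RV; apply: R3_get; rec_tac.
Qed.

Hypotheses (RU : R1 U) (RV : R1 (V U)).

Ltac rec_eval := lazymatch goal with
  | |- recs _ (fun s => lookup _ _ _) => apply: R3_lookup; rec_tac
  | |- recs _ (fun s => term_val _ _ _) => apply: (R3_term_val RV); rec_tac
  | |- recs _ (fun s => get _ _ _) => apply: R3_get; rec_tac
  | |- recs _ (fun s => U _) => apply: RU; rec_tac
  | |- _ => rec_unpair
  end.
Ltac rec_hint ::= rec_eval.

Lemma recs_formula_val : recs 4 (fun s => formula_val (nth 0 s 1) (nth 0 s 2) (nth 0 s 3)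
  (nth 0 s 0) 0).
Proof.
have H : recs 4 (fun s => cov formula_step (behead s) (nth 0 s 0)).
  apply: recs_cov.
  rewrite /formula_step /formula_step_at /admissible /agree /sub_val /lev.
  by rec_tac.
apply: (@recs_ext _ (fun s => (fun z p => cov formula_step p z)
  (nth 0 s 0 * nth 0 s 3 ^ (nth 0 s 1).+1) (behead s))).
  apply: (@recs_subst_head 3 (fun z p => cov formula_step p z)
    (fun s => nth 0 s 0 * nth 0 s 3 ^ (nth 0 s 1).+1)) => //.
  by rec_tac.
move=> s ss; rewrite /formula_val addn0.
have -> // : behead s = [:: nth 0 s 1; nth 0 s 2; nth 0 s 3].
by case: s ss => [|a [|b [|c [|d []]]]].
Qed.

Hypotheses (U0 : U 0 = 1) (Uinc : forall i, U i < U i.+1).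

(** A subformula has a smaller code, so its level exceeds the current one by at least [T], which is
    the room that [wit] asks for. The Boolean [b] lets [wit] supply small counterexamples, for
    [FAll], as well as small witnesses. *)
Lemma formula_valP (C T : nat) :
  (forall f (b : bool) x v L d, code f <= C -> (forall y, v y < U L) ->
     (holds U (update v x d) f <-> b) ->
     exists2 d', d' < U (L + T) & (holds U (update v x d') f <-> b)) ->
  forall phi v, code phi <= C -> v < U (C * T) ^ C.+1 ->
    (forall y, lookup (U (C * T)) v y < U (lev C T (code phi))) ->
    reflect (holds U (lookup (U (C * T)) v) phi)
      (formula_val C T (U (C * T)) (code phi) v == 1).
Proof.
move=> wit; set B := U (C * T); set W := B ^ C.+1.
have B0 : 0 < B by exact: U_gt0.
have W0 : 0 < W by rewrite expn_gt0 B0.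
have valE c v : v < W -> exists h,
    formula_val C T B c v = formula_step_at C T B W (c * W + v) h c v /\
    forall c' v', c' < c -> v' < W ->
      sub_val h (c * W + v) W c' v' = (formula_val C T B c' v' == 1).
  move=> vW; exists (hist formula_step [:: C; T; B] (c * W + v)); split.
    rewrite /formula_val /cov {1}/formula_step [nth 0 _ 0]/= [nth 0 _ 1]/= [nth 0 _ 2]/=.
    by rewrite -/W divnMDl // modnMDl divn_small // addn0 modn_small.
  move=> c' v' cc v'W; rewrite /sub_val get_hist //.
  apply: leq_trans (leq_addr _ _); apply: leq_trans (_ : c'.+1 * W <= _).
    by rewrite mulSn addnC ltn_add2r.
  by rewrite leq_mul2r cc orbT.
have levS c c' : c' < c -> c <= C -> lev C T c + T <= lev C T c'.
  by move=> cc cC; rewrite /lev -mulSnr leq_mul2r; apply/orP; right; lia.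
have levW c c' : c' < c -> U (lev C T c) <= U (lev C T c').
  by move=> cc; apply: (leq_U Uinc); rewrite /lev leq_mul2r leq_sub2l ?orbT // ltnW.
have levB c : U (lev C T c) <= B.
  by apply: (leq_U Uinc); rewrite /lev leq_mul2r leq_subr orbT.
have admP x c v v' : x <= C -> v < W -> v' < W ->
    reflect (lookup B v' = update (lookup B v) x (lookup B v' x) /\
             lookup B v' x < U (lev C T c)) (admissible C T B x c v v').
  move=> xC vW vW'; apply: (iffP andP) => -[H1 H2]; split=> //.
    apply: funext => y; rewrite /update; case: eqP => [-> //|/eqP yx].
    have [yC|Cy] := leqP y C; last by rewrite !(lookup_out (n := C.+1)).
    move/allP: H1 => /(_ y); rewrite mem_iota add0n ltnS yC (negbTE yx) /=.
    by move=> /(_ isT) /eqP.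
  apply/allP => y _; rewrite H1 /update; case: (y == x) => //=.
(* An arbitrary witness is replaced by a small one, and the updated valuation is coded in the search
   range; [up] is the converse reading of an admissible code. *)
have down x f (b : bool) v : x <= C -> code f < C.+1 -> forall c, code f < c -> c <= C -> v < W ->
    (forall y, lookup B v y < U (lev C T c)) ->
    forall d, (holds U (update (lookup B v) x d) f <-> b) ->
    exists v', [/\ v' < W, admissible C T B x (code f) v v' &
      (holds U (lookup B v') f <-> b) /\ forall y, lookup B v' y < U (lev C T (code f))].
  move=> xC fC c fc cC vW vL d Hd.
  have [d' d'L Hd'] := wit f b x (lookup B v) _ d fC vL Hd.
  have d'L2 : d' < U (lev C T (code f)).
    exact: leq_trans d'L (leq_U Uinc (levS _ _ fc cC)).
  have bnd y : update (lookup B v) x d' y < U (lev C T (code f)).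
    rewrite /update; case: eqP => // _; exact: leq_trans (vL y) (levW _ _ fc).
  have [v' v'W v'E] := lookup_surj C.+1 (fun y => leq_trans (bnd y) (levB _)).
  have E : lookup B v' = update (lookup B v) x d'.
    apply: funext => y; rewrite v'E ltnS; case: leqP => // Cy.
    rewrite /update; case: eqP => [yx|_]; first by lia.
    by rewrite (lookup_out (n := C.+1)).
  exists v'; rewrite E; split=> //; apply/admP => //.
  by rewrite E /update eqxx.
have up x c v v' : x <= C -> v < W -> v' < W -> (forall y, lookup B v y < U (lev C T c)) ->
    forall c', c' < c -> admissible C T B x c' v v' ->
    lookup B v' = update (lookup B v) x (lookup B v' x) /\
    forall y, lookup B v' y < U (lev C T c').
  move=> xC vW v'W vL c' cc /(admP _ _ _ _ xC vW v'W)[E lt]; split=> // y.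
  rewrite E /update; case: eqP => // _; exact: leq_trans (vL y) (levW _ _ cc).
have step2 k f g v : 0 < k -> cantor k (cantor (code f) (code g)) <= C ->
    (forall y, lookup B v y < U (lev C T (cantor k (cantor (code f) (code g))))) ->
    [/\ code f < cantor k (cantor (code f) (code g)),
        code g < cantor k (cantor (code f) (code g)), code f <= C, code g <= C &
    (forall y, lookup B v y < U (lev C T (code f))) /\
    (forall y, lookup B v y < U (lev C T (code g)))].
  move=> k0 cC vL.
  have lt := ltn_cantor_r (cantor (code f) (code g)) k0.
  have lf := leq_ltn_trans (leq_cantor_l (code f) (code g)) lt.
  have lg := leq_ltn_trans (leq_cantor_r (code f) (code g)) lt.
  split=> //; [exact: leq_trans (ltnW lf) cC|exact: leq_trans (ltnW lg) cC|].
  by split=> y; apply: leq_trans (vL y) (levW _ _ _).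
have step1 k x f : 0 < k -> cantor k (cantor x (code f)) <= C ->
    [/\ code f < cantor k (cantor x (code f)), x <= C & code f <= C].
  move=> k0 cC; have lt := ltn_cantor_r (cantor x (code f)) k0.
  have lf := leq_ltn_trans (leq_cantor_r x (code f)) lt.
  have lx := leq_ltn_trans (leq_cantor_l x (code f)) lt.
  by split=> //; [exact: leq_trans (ltnW lx) cC|exact: leq_trans (ltnW lf) cC].
have refl1 P (b : bool) : reflect P b -> reflect P (nat_of_bool b == 1).
  by case=> H; constructor.
elim=> [t1 t2|f IH|f IHf g IHg|f IHf g IHg|f IHf g IHg|x f IH|x f IH] v cC vW vL;
  set c := (X in formula_val _ _ _ X _); have [h [-> subE]] := cid (valE c v vW);
  rewrite {}/c [code _]/= in cC vL subE *;
  rewrite /formula_step_at !cfstK !csndK ?cfstK; apply: refl1.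
- by rewrite !term_valE; apply: eqP.
- have lt := ltn_cantor_r (code f) (isT : 0 < 1).
  rewrite subE //; apply: (iffP negP) => H ?; apply: H; apply/IH => //;
    rewrite ?(leq_trans (ltnW lt)) // => y; exact: leq_trans (vL y) (levW _ _ lt).
- have [lf lg fC gC [vf vg]] := step2 2 f g v isT cC vL.
  rewrite !subE //.
  by apply: (iffP andP) => -[] /(IHf _ fC vW vf) ? /(IHg _ gC vW vg).
- have [lf lg fC gC [vf vg]] := step2 3 f g v isT cC vL.
  rewrite !subE //.
  by apply: (iffP orP) => -[/(IHf _ fC vW vf)|/(IHg _ gC vW vg)]; [left|right|left|right].
- have [lf lg fC gC [vf vg]] := step2 4 f g v isT cC vL.
  rewrite !subE //.
  by apply: (iffP implyP) => H /(IHf _ fC vW vf) /H /(IHg _ gC vW vg).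
- have [lf xC fC] := step1 5 x f isT cC.
  apply: (iffP hasP) => [[v']|[d Hd]].
    rewrite mem_iota add0n => /= v'W /andP[adm]; rewrite subE // => Hv'.
    have [E bnd] := up _ _ _ _ xC vW v'W vL _ lf adm.
    by exists (lookup B v' x); rewrite -E; apply/IH.
  have Hd' : holds U (update (lookup B v) x d) f <-> true by [].
  have [v' [v'W adm [Hv' bnd]]] := down _ _ _ _ xC fC _ lf cC vW vL _ Hd'.
  by exists v'; rewrite ?mem_iota ?add0n // adm subE //; apply/IH => //; apply/Hv'.
- have [lf xC fC] := step1 6 x f isT cC.
  apply: (iffP allP) => H.
    move=> d; apply: contrapT => Hd.
    have Hd' : holds U (update (lookup B v) x d) f <-> false by split.
    have [v' [v'W adm [Hv' bnd]]] := down _ _ _ _ xC fC _ lf cC vW vL _ Hd'.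
    have := H v'; rewrite mem_iota add0n => /(_ v'W); rewrite adm subE //=.
    by move/IH => /(_ fC v'W bnd) /Hv'.
  move=> v'; rewrite mem_iota add0n => /= v'W; apply/implyP => adm.
  have [E bnd] := up _ _ _ _ xC vW v'W vL _ lf adm.
  by rewrite subE //; apply/IH => //; rewrite E.
Qed.

End Evaluator.

(** * Recognisable relations *)

(** If [u] is longer than the number of states, two of its prefixes reach the same state and the
    factor between them can be cut out. *)
Lemma foldl_short (S : finType) (A : Type) (step : S -> A -> S) (s : S) (u : seq A) :
  exists2 u', size u' <= #|S| & foldl step s u' = foldl step s u.
Proof.
have [m] := ubnP (size u); elim: m u => // m IH u um.
have [uS|Su] := leqP (size u) #|S|; first by exists u.
pose g (i : 'I_(size u).+1) := foldl step s (take i u).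
have /injectivePn[i [j ij gij]] : ~~ injectiveb g.
  apply/injectiveP => /leq_card; rewrite card_ord leqNgt ltnS ltnW //.
wlog lij : i j ij gij / i < j.
  move=> H; have [/H|/H|] := ltngtP i j; [by apply|by apply; rewrite 1?eq_sym|].
  by move/val_inj => e; rewrite e eqxx in ij.
have [|u' us ue] := IH (take i u ++ drop j u).
  rewrite -ltnS; apply: leq_trans um; rewrite ltnS size_cat size_take size_drop.
  by have := ltn_ord i; have := ltn_ord j; case: ifP; lia.
exists u' => //; rewrite ue foldl_cat -[foldl _ s (take i u)]/(g i) gij /g.
by rewrite -foldl_cat cat_take_drop.
Qed.

Section Recognisable.
Variable U : nat -> nat.
Hypotheses (U0 : U 0 = 1) (Uinc : forall i, U i < U i.+1).

(* Words are read most significant digit first. *)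
Fixpoint digs (L m : nat) : seq nat :=
  if L is L'.+1 then m %/ U L' :: digs L' (m %% U L') else [::].

(** One letter carries the digits of all variables at once, so the alphabet is infinite; only the
    set of states has to be finite. *)
Fixpoint vword (L : nat) (v : nat -> nat) : seq (nat -> nat) :=
  if L is L'.+1 then (fun x => v x %/ U L') :: vword L' (fun x => v x %% U L')
  else [::].

(** The equivalence is required at every length [L] that accommodates [v], hence with any number of
    leading zeros. Of the automaton only the bound [N] is remembered. *)
Definition recog (N : nat) (R : (nat -> nat) -> Prop) : Prop :=
  exists (Q : finType) (delta : Q -> (nat -> nat) -> Q) (q0 : Q) (F : pred Q),
    #|Q| <= N /\
    forall L v, (forall x, v x < U L) -> (R v <-> F (foldl delta q0 (vword L v))).

(** Needed for projection: guessed digits must be the greedy expansion of a number, and not just any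
    word of digits. Leading zeros are allowed. *)
Definition greedy_automaton (K : nat) : Prop :=
  exists (Q : finType) (gamma : Q -> nat -> Q) (g0 : Q) (F : pred Q),
    #|Q| <= K /\
    forall w, F (foldl gamma g0 w) <->
      exists2 m, m < U (size w) & w = digs (size w) m.

Lemma size_digs L m : size (digs L m) = L.
Proof. by elim: L m => //= L IH m; rewrite IH. Qed.

Lemma size_vword L v : size (vword L v) = L.
Proof. by elim: L v => //= L IH v; rewrite IH. Qed.

Lemma recog_ext N R R' : recog N R -> (forall v, R v <-> R' v) -> recog N R'.
Proof.
move=> [Q [delta [q0 [F [QN HF]]]]] E; exists Q, delta, q0, F; split=> // L v vL.
by rewrite -E; exact: HF.
Qed.

Lemma recog_leq N N' R : N <= N' -> recog N R -> recog N' R.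
Proof.
move=> NN [Q [delta [q0 [F [QN HF]]]]]; exists Q, delta, q0, F; split=> //.
exact: leq_trans QN NN.
Qed.

Lemma recog_not N R : recog N R -> recog N (fun v => ~ R v).
Proof.
move=> [Q [delta [q0 [F [QN HF]]]]]; exists Q, delta, q0, (predC F); split=> // L v vL.
by rewrite (HF L v vL) /=; split=> /negP.
Qed.

Lemma recog_and N1 N2 R1 R2 : recog N1 R1 -> recog N2 R2 ->
  recog (N1 * N2) (fun v => R1 v /\ R2 v).
Proof.
move=> [Q1 [d1 [q1 [F1 [QN1 HF1]]]]] [Q2 [d2 [q2 [F2 [QN2 HF2]]]]].
exists (Q1 * Q2)%type, (fun q a => (d1 q.1 a, d2 q.2 a)), (q1, q2),
  (fun q => F1 q.1 && F2 q.2); split; first by rewrite card_prod leq_mul.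
move=> L v vL; rewrite (HF1 L v vL) (HF2 L v vL).
have -> w : foldl (fun q a => (d1 q.1 a, d2 q.2 a)) (q1, q2) w =
    (foldl d1 q1 w, foldl d2 q2 w).
  by elim: w q1 q2 {HF1 HF2} => //= a w IH q1 q2; rewrite IH.
by split=> [[-> ->] | /andP[]].
Qed.

Definition zipu x (w : seq (nat -> nat)) (u : seq nat) : seq (nat -> nat) :=
  [seq update a.1 x a.2 | a <- zip w u].

Lemma vword_update x L v m : vword L (update v x m) = zipu x (vword L v) (digs L m).
Proof.
elim: L v m => //= L IH v m; rewrite /zipu /=; congr cons.
  by apply: funext => y; rewrite /update; case: eqP.
rewrite -/(zipu x _ _) -IH; congr vword.
by apply: funext => y; rewrite /update; case: eqP.
Qed.

Lemma vword_pad L' L v : (forall x, v x < U L) ->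
  vword (L' + L) v = nseq L' (fun=> 0) ++ vword L v.
Proof.
move=> vL; elim: L' => //= L' IH.
have vL' x : v x < U (L' + L) by apply: leq_trans (vL x) (leq_U Uinc (leq_addl _ _)).
congr cons; first by apply: funext => x; rewrite divn_small.
by rewrite -IH; congr vword; apply: funext => x; rewrite modn_small.
Qed.

(** * Projection by the subset construction, and pumping of witnesses *)

Section Exists.
Variables (Q : finType) (delta : Q -> (nat -> nat) -> Q) (q0 : Q) (F : pred Q).
Variables (R : (nat -> nat) -> Prop) (x : nat).
Hypothesis HF : forall L v, (forall x, v x < U L) ->
  (R v <-> F (foldl delta q0 (vword L v))).
Variables (G : finType) (gamma : G -> nat -> G) (g0 : G) (E : pred G).
Hypothesis HE : forall w, E (foldl gamma g0 w) <->
  exists2 m, m < U (size w) & w = digs (size w) m.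

(** Reads the digits by which the witness is longer than the word of the parameters; all other
    variables have digit 0 there. [tail] reads the remaining digits along with that word. *)
Let head (u : seq nat) : Q * G :=
  foldl (fun p d => (delta p.1 (update (fun=> 0) x d), gamma p.2 d)) (q0, g0) u.

Let tail (p : Q * G) (w : seq (nat -> nat)) (u : seq nat) : Q * G :=
  (foldl delta p.1 (zipu x w u), foldl gamma p.2 u).

Lemma headE u : head u =
  (foldl delta q0 (zipu x (nseq (size u) (fun=> 0)) u), foldl gamma g0 u).
Proof.
rewrite /head; elim/last_ind: u => // u d IH.
rewrite !foldl_rcons IH /= size_rcons -addn1 nseqD -cats1 /zipu zip_cat ?size_nseq //.
by rewrite map_cat /= foldl_cat.
Qed.

Lemma run_update L v u1 u2 m : (forall y, v y < U L) -> size u2 = L ->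
  digs (size u1 + L) m = u1 ++ u2 ->
  tail (head u1) (vword L v) u2 =
  (foldl delta q0 (vword (size u1 + L) (update v x m)), foldl gamma g0 (u1 ++ u2)).
Proof.
move=> vL su2 Em; rewrite vword_update Em vword_pad // /tail headE /=.
by rewrite /zipu zip_cat ?size_nseq // map_cat !foldl_cat.
Qed.

Lemma update_lt v d L : (forall y, v y < U L) -> d < U L ->
  forall y, update v x d y < U L.
Proof. by move=> vL dL y; rewrite /update; case: eqP. Qed.

Lemma head_tail_of_witness L v d : (forall y, v y < U L) -> R (update v x d) ->
  exists u1 u2, [/\ size u2 = L, F (tail (head u1) (vword L v) u2).1
                  & E (tail (head u1) (vword L v) u2).2].
Proof.
(* Since [d < U d], it is enough to allow [d] excess digits. *)
move=> vL Rd; pose w := digs (d + L) d; pose u1 := take d w; pose u2 := drop d w.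
have su1 : size u1 = d by rewrite size_takel // size_digs leq_addr.
have su2 : size u2 = L by rewrite size_drop size_digs addKn.
have Ew : digs (size u1 + L) d = u1 ++ u2 by rewrite su1 cat_take_drop.
have dL : d < U (size u1 + L).
  by rewrite su1; apply: leq_trans (ltn_U U0 Uinc d) (leq_U Uinc (leq_addr _ _)).
have vL' y : v y < U (size u1 + L) by apply: leq_trans (vL y) (leq_U Uinc (leq_addl _ _)).
exists u1, u2; split=> //; rewrite (run_update vL su2 Ew) /=.
  by apply/HF => //; exact: update_lt.
by apply/HE; rewrite -Ew size_digs; exists d.
Qed.

Lemma witness_of_head_tail L v u1 u2 : (forall y, v y < U L) -> size u2 = L ->
  F (tail (head u1) (vword L v) u2).1 -> E (tail (head u1) (vword L v) u2).2 ->
  exists2 d, d < U (size u1 + L) & R (update v x d).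
Proof.
move=> vL su2 HFt HEt.
have /HE[m] : E (foldl gamma g0 (u1 ++ u2)).
  by move: HEt; rewrite /tail headE /= foldl_cat.
rewrite size_cat su2 => mL Em; exists m => //.
have vL' y : v y < U (size u1 + L) by apply: leq_trans (vL y) (leq_U Uinc (leq_addl _ _)).
apply/(HF (update_lt vL' mL)).
by move: HFt; rewrite (run_update vL su2 (esym Em)).
Qed.

Lemma recog_ex_aux : recog (2 ^ (#|Q| * #|G|)) (fun v => exists d, R (update v x d)).
Proof.
pose step (S : {set Q * G}) (a : nat -> nat) : {set Q * G} :=
  [set p | `[< exists2 p0, p0 \in S &
     exists d, p = (delta p0.1 (update a x d), gamma p0.2 d) >]].
(* The witness may have any number of excess digits, so runs start in every state that [head] can
   reach. *)
pose S0 : {set Q * G} := [set p | `[< exists u, p = head u >]].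
have stepP (S : {set Q * G}) w p : reflect (exists2 p0, p0 \in S & exists2 u, size u = size w & p = tail p0 w u)
    (p \in foldl step S w).
  apply: (iffP idP); elim: w S p => [|a w IH] S p /=.
  - by move=> pS; exists p => //; exists [::] => //; rewrite /tail; case: (p).
  - case/IH => p1; rewrite inE => /asboolP[p0 p0S [d ->]] [u su ->].
    by exists p0 => //; exists (d :: u); rewrite /= ?su.
  - by case=> p0 p0S [[|//] _ ->]; rewrite /tail; case: (p0) p0S.
  - case=> p0 p0S [[//|d u] [su] ->]; apply: IH.
    exists (delta p0.1 (update a x d), gamma p0.2 d); last by exists u.
    by rewrite inE; apply/asboolP; exists p0 => //; exists d.
exists {set Q * G}, step, S0, (fun S : {set Q * G} => [exists p in S, F p.1 && E p.2]); split.
  by rewrite -cardsT -powersetT card_powerset cardsT card_prod.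
move=> L v vL; split=> [[d Rd]|/existsP[p /and3P[]]].
  have [u1 [u2 [su2 H1 H2]]] := head_tail_of_witness vL Rd.
  apply/existsP; exists (tail (head u1) (vword L v) u2); rewrite H1 H2 andbT andbT.
  apply/stepP; exists (head u1); last by exists u2; rewrite // size_vword.
  by rewrite inE; apply/asboolP; exists u1.
case/stepP => p0; rewrite inE => /asboolP[u1 ->] [u2]; rewrite size_vword => su2 -> H1 H2.
by have [d _ Rd] := witness_of_head_tail vL su2 H1 H2; exists d.
Qed.

(** Only the excess digits are pumped: their run does not involve [v], and the rest of the run is
    kept as it is. *)
Lemma witness_bound_aux L v d : (forall y, v y < U L) -> R (update v x d) ->
  exists2 d', d' < U (L + #|Q| * #|G|) & R (update v x d').
Proof.
move=> vL Rd; have [u1 [u2 [su2 H1 H2]]] := head_tail_of_witness vL Rd.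
have [u1' su1' Eu] := foldl_short (fun p d =>
  (delta p.1 (update (fun=> 0) x d), gamma p.2 d)) (q0, g0) u1.
rewrite -[head u1]Eu -/(head u1') in H1 H2.
have [d' d'L Rd'] := witness_of_head_tail vL su2 H1 H2.
exists d' => //; apply: leq_trans d'L (leq_U Uinc _).
by rewrite addnC leq_add2l -card_prod.
Qed.

End Exists.

Lemma recog_ex K N R x : greedy_automaton K -> recog N R ->
  recog (2 ^ (N * K)) (fun v => exists d, R (update v x d)).
Proof.
move=> [G [gamma [g0 [E [GK HE]]]]] [Q [delta [q0 [F [QN HF]]]]].
apply: recog_leq (recog_ex_aux x HF HE).
by rewrite leq_pexp2l // leq_mul.
Qed.

Lemma witness_bound K N R x L v d : greedy_automaton K -> recog N R ->
  (forall y, v y < U L) -> R (update v x d) ->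
  exists2 d', d' < U (L + N * K) & R (update v x d').
Proof.
move=> [G [gamma [g0 [E [GK HE]]]]] [Q [delta [q0 [F [QN HF]]]]] vL Rd.
have [d' d'L Rd'] := witness_bound_aux HF HE vL Rd.
exists d' => //; apply: leq_trans d'L (leq_U Uinc _).
by rewrite leq_add2l leq_mul.
Qed.

End Recognisable.

(** * Bounds on the numbers of states *)

Section Tower.
Variable K : nat.
Hypothesis K0 : 0 < K.

(** The state count for two existential quantifiers in front of a conjunction of automata with [N],
    [N] and [K] states, as in [recog_two]. It also dominates one binary connective or one
    quantifier. *)
Definition tower_step (N : nat) : nat := 2 ^ (2 ^ (N * (N * K) * K) * K).
Definition tower (c : nat) : nat := iter c tower_step K.

Lemma leq_exp2 N : N <= 2 ^ (N * K).
Proof. by apply: leq_trans (ltnW (ltn_expl _ (isT : 1 < 2))); exact: leq_pmulr. Qed.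

Lemma leq_tower_step2 N : N * (N * K) <= tower_step N.
Proof. exact: leq_trans (leq_exp2 _) (leq_exp2 _). Qed.

Lemma leq_tower_step1 N : 0 < N -> 2 ^ (N * K * K) <= tower_step N.
Proof.
move=> N0; apply: leq_trans (leq_exp2 _); rewrite leq_pexp2l // leq_mul2r.
by rewrite leq_pmull ?orbT.
Qed.

Lemma leq_tower_step0 N : N <= tower_step N.
Proof.
have [->|N0] := posnP N; first by [].
by apply: leq_trans (leq_tower_step2 N); rewrite leq_pmulr // muln_gt0 N0.
Qed.

Lemma leq_tower c c' : c <= c' -> tower c <= tower c'.
Proof.
elim: c' => [|c' IH]; rewrite leq_eqVlt => /orP[/eqP->|] // cc.
exact: leq_trans (IH cc) (leq_tower_step0 _).
Qed.

Lemma tower_gt0 c : 0 < tower c.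
Proof. exact: leq_trans K0 (leq_tower (leq0n c)). Qed.

Lemma R1_tower : R1 tower.
Proof.
move=> k f Hf; have R : R1 tower_step.
  by apply: R1P; rewrite /tower_step; rec_tac.
have := R2_iter R (a := fun=> K) _ Hf Hf; apply.
by move=> k' f' _; exact: recs_const.
Qed.

End Tower.

(** * From formulas to automata *)

Lemma eq_eval U v w t : {in term_vars t, v =1 w} -> eval U v t = eval U w t.
Proof.
elim: t => /= [x H|t1 IH1 t2 IH2 H|t IH H]; first by rewrite H // inE.
  by rewrite IH1 ?IH2 // => x xt; apply: H; rewrite mem_cat xt ?orbT.
by rewrite IH.
Qed.

Definition fresh (s : seq nat) : nat := (foldr maxn 0 s).+1.

Lemma fresh_gt s x : x \in s -> x < fresh s.
Proof.
rewrite /fresh ltnS; elim: s => //= y s IH; rewrite inE => /orP[/eqP ->|/IH xs].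
  exact: leq_maxl.
exact: leq_trans xs (leq_maxr _ _).
Qed.

Section FormulaRecog.
Variable U : nat -> nat.
Hypotheses (U0 : U 0 = 1) (Uinc : forall i, U i < U i.+1).
Variable K : nat.
Hypotheses (K0 : 0 < K) (HG : greedy_automaton U K).
Hypothesis recog_eq : forall x y, recog U K (fun v => v x = v y).
Hypothesis recog_add : forall x y z, recog U K (fun v => v x + v y = v z).
Hypothesis recog_V : forall x y, recog U K (fun v => V U (v x) = v y).

Let h := tower K.

Lemma recog_two N R1 R2 R3 y z : recog U N R1 -> recog U N R2 -> recog U K R3 ->
  recog U (tower_step K N) (fun v => exists d e,
    (fun w => R1 w /\ R2 w /\ R3 w) (update (update v y d) z e)).
Proof.
move=> H1 H2 H3; have H := recog_and H1 (recog_and H2 H3).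
exact: (recog_ex U0 Uinc y HG (recog_ex U0 Uinc z HG H)).
Qed.

(** The values of both terms are named by fresh existentially quantified variables, which reduces
    the relation to one between variables. The list [s] contains the variables on which [P] itself
    depends. *)
Lemma recog_terms N t1 t2 (s : seq nat) (P : nat -> nat -> (nat -> nat) -> Prop) :
  (forall x, recog U N (fun v => eval U v t1 = v x)) ->
  (forall x, recog U N (fun v => eval U v t2 = v x)) ->
  (forall y z, recog U K (fun w => P (w y) (w z) w)) ->
  (forall a b v w, {in s, v =1 w} -> P a b v <-> P a b w) ->
  recog U (tower_step K N) (fun v => P (eval U v t1) (eval U v t2) v).
Proof.
move=> H1 H2 H3 HP.
set y := fresh (s ++ term_vars t1 ++ term_vars t2).
apply: (recog_ext (recog_two y y.+1 (H1 y) (H2 y.+1) (H3 y y.+1))) => v /=.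
have E d e : {in s ++ term_vars t1 ++ term_vars t2, v =1 update (update v y d) y.+1 e}.
  move=> u /fresh_gt; rewrite -/y => uy; rewrite /update.
  by rewrite ltn_eqF ?ltn_eqF // ltnS ltnW.
have Ey d e : update (update v y d) y.+1 e y = d.
  by rewrite /update ltn_eqF ?eqxx.
have Ez d e : update (update v y d) y.+1 e y.+1 = e by rewrite /update eqxx.
have E1 d e : eval U (update (update v y d) y.+1 e) t1 = eval U v t1.
  by apply/esym/eq_eval => u ut; apply: E; rewrite !mem_cat ut orbT.
have E2 d e : eval U (update (update v y d) y.+1 e) t2 = eval U v t2.
  by apply/esym/eq_eval => u ut; apply: E; rewrite !mem_cat ut !orbT.
have EP d e a b : P a b v <-> P a b (update (update v y d) y.+1 e).
  by apply: HP => u us; apply: E; rewrite mem_cat us.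
split=> [[d [e []]]|H].
  by rewrite E1 E2 Ey Ez => -> [-> /EP].
exists (eval U v t1), (eval U v t2); rewrite E1 E2 Ey Ez; split=> //; split=> //.
exact/EP.
Qed.

Lemma recog_term t x : recog U (h (code_term t)) (fun v => eval U v t = v x).
Proof.
elim: t x => /= [y|t1 IH1 t2 IH2|t IH] x.
- exact: recog_leq (leq_tower K0 (leq0n _)) (recog_eq y x).
- set c := cantor 1 _; have lt : cantor (code_term t1) (code_term t2) < c.
    exact: ltn_cantor_r.
  apply: (@recog_leq _ (tower_step K (h c.-1))).
    by rewrite /h /tower -iterS (ltn_predK lt).
  apply: (@recog_terms _ _ _ [:: x] (fun a b v => a + b = v x)) => //.
  + move=> z; apply: recog_leq (IH1 z); apply: leq_tower => //.
    by rewrite -ltnS (ltn_predK lt) (leq_ltn_trans _ lt) // leq_cantor_l.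
  + move=> z; apply: recog_leq (IH2 z); apply: leq_tower => //.
    by rewrite -ltnS (ltn_predK lt) (leq_ltn_trans _ lt) // leq_cantor_r.
  + by move=> a b v w E; rewrite E // inE.
- set c := cantor 2 _; have lt : code_term t < c by exact: ltn_cantor_r.
  apply: (@recog_leq _ (tower_step K (h c.-1))).
    by rewrite /h /tower -iterS (ltn_predK lt).
  have H z : recog U (h c.-1) (fun v => eval U v t = v z).
    apply: recog_leq (IH z); apply: leq_tower => //.
    by rewrite -ltnS (ltn_predK lt).
  (* The unary symbol is handled by the binary lemma, with the same term twice. *)
  apply: (@recog_terms _ t t [:: x] (fun a b v => V U a = v x)) => //.
  by move=> a b v w E; rewrite E // inE.
Qed.

(** The successor is spent on equations: their tag is 0, so the codes of their two terms need not be
    strictly smaller. *)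
Lemma recog_formula phi : recog U (h (code phi).+1) (fun v => holds U v phi).
Proof.
have down c c' R : c <= c' -> recog U (h c) R -> recog U (h c') R.
  by move=> cc; apply: recog_leq; exact: leq_tower.
have both c R1 R2 : recog U (h c) R1 -> recog U (h c) R2 ->
    recog U (h c.+1) (fun v => R1 v /\ R2 v).
  move=> H1 H2; apply: recog_leq (recog_and H1 H2).
  by apply: leq_trans (leq_tower_step2 K0 _); rewrite leq_mul2l leq_pmulr ?orbT.
have exK c R x : recog U (h c) R -> recog U (h c.+1) (fun v => exists d, R (update v x d)).
  move=> H; apply: recog_leq (recog_ex U0 Uinc x HG H).
  apply: leq_trans (leq_tower_step1 K0 (tower_gt0 K0 c)).
  by rewrite leq_pexp2l // leq_mul2r leq_pmulr ?orbT.
have ltl k a b : 0 < k -> a < cantor k (cantor a b).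
  by move=> k0; exact: leq_ltn_trans (leq_cantor_l a b) (ltn_cantor_r _ k0).
have ltr k a b : 0 < k -> b < cantor k (cantor a b).
  by move=> k0; exact: leq_ltn_trans (leq_cantor_r a b) (ltn_cantor_r _ k0).
elim: phi => /= [t1 t2|f IH|f IHf g IHg|f IHf g IHg|f IHf g IHg|x f IH|x f IH].
- set c := cantor 0 _; apply: (@recog_terms (h c) t1 t2 [::] (fun a b _ => a = b)) => //.
    move=> x; apply: down (recog_term t1 x).
    exact: leq_trans (leq_cantor_l _ _) (leq_cantor_r _ _).
  move=> x; apply: down (recog_term t2 x).
  exact: leq_trans (leq_cantor_r _ _) (leq_cantor_r _ _).
- have le : (code f).+1 <= (cantor 1 (code f)).+1 by rewrite ltnS ltnW // ltn_cantor_r.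
  exact: recog_not (down _ _ _ le IH).
- have Hf := down _ _ _ (ltl 2 _ (code g) isT) IHf.
  have Hg := down _ _ _ (ltr 2 (code f) _ isT) IHg.
  exact: both Hf Hg.
- have Hf := down _ _ _ (ltl 3 _ (code g) isT) (recog_not IHf).
  have Hg := down _ _ _ (ltr 3 (code f) _ isT) (recog_not IHg).
  apply: recog_ext (recog_not (both _ _ _ Hf Hg)) _ => v.
  by split=> [H|[?|?] []] //; apply: contrapT => H'; apply: H; split=> ?; apply: H';
    [left|right].
- have Hf := down _ _ _ (ltl 4 _ (code g) isT) IHf.
  have Hg := down _ _ _ (ltr 4 (code f) _ isT) (recog_not IHg).
  apply: recog_ext (recog_not (both _ _ _ Hf Hg)) _ => v.
  by split=> [H Hv|H [/H]] //; apply: contrapT => H'; apply: H.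
- exact: exK _ _ x (down _ _ _ (ltr 5 x _ isT) IH).
- have H := exK _ _ x (down _ _ _ (ltr 6 x _ isT) (recog_not IH)).
  apply: recog_ext (recog_not H) _ => v.
  by split=> [H1 d|H1 [d]]; [apply: contrapT => H2; apply: H1; exists d | apply].
Qed.

Theorem recursive_truth : R1 U -> R1 (V U) ->
  exists2 f, R1 f & forall phi, (holds U (fun=> 0) phi -> f (code phi) = 1) /\
                                (~ holds U (fun=> 0) phi -> f (code phi) = 0).
Proof.
(* Formulas with codes at most [C] have automata with at most [h C.+1] states, so [witness_bound]
   allows this number of additional digits. *)
move=> RU RV; pose T C := h C.+1 * K.
pose f C := nat_of_bool (formula_val U C (T C) (U (C * T C)) C 0 == 1).
exists f.
  have RT : R1 T by apply: R1P; rewrite /T; apply: R2_muln; [apply: R1_tower|]; rec_tac.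
  apply: R1P; rewrite /f; apply: recs_eq; last by rec_tac.
  have RB : R1 (fun C => U (C * T C)).
    by apply: R1P; apply: RU; apply: R2_muln; [|apply: RT]; rec_tac.
  apply: (@recs_comp 1 _ [:: nth 0 ^~ 0; nth 0 ^~ 0; (fun s => T (nth 0 s 0));
    (fun s => U (nth 0 s 0 * T (nth 0 s 0)))] (recs_formula_val RU RV)).
  by case=> [|[|[|[|//]]]] _ /=; [exact: recs_var|exact: recs_var|
    apply: RT; exact: recs_var|apply: RB; exact: recs_var].
move=> phi; set C := code phi.
have wit f0 (b : bool) x v L d : code f0 <= C -> (forall y, v y < U L) ->
    (holds U (update v x d) f0 <-> b) ->
    exists2 d', d' < U (L + T C) & (holds U (update v x d') f0 <-> b).
  move=> fC vL Hd.
  have RR : recog U (h C.+1) (fun w => holds U w f0 <-> b).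
    apply: (@recog_leq _ (h (code f0).+1)); first exact: leq_tower.
    case: b {Hd}; first by apply: recog_ext (recog_formula f0) _ => w; split=> [//|[_]]; exact.
    apply: recog_ext (recog_not (recog_formula f0)) _ => w.
    by split=> [H|[H _] /H] //; split.
  exact: (witness_bound U0 Uinc HG RR vL Hd).
have l0 : lookup (U (C * T C)) 0 = fun=> 0.
  by apply: funext => y; rewrite /lookup div0n mod0n.
have := formula_valP U0 Uinc wit (phi := phi) (v := 0) (leqnn _); rewrite -/C l0.
rewrite expn_gt0 U_gt0 // => /(_ isT (fun=> U_gt0 U0 Uinc _)) r.
by rewrite /f; case: r.
Qed.

End FormulaRecog.

(** * Growth of Pisot numeration systems *)

Local Open Scope ring_scope.

Section ShiftOperator.
Variable R : nzRingType.
Implicit Types (p q : {poly R}) (u : nat -> R).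

(** The polynomial [p] in the shift operator, applied to the sequence [u]; a recurrence with
    characteristic polynomial [p] says that this vanishes. *)
Definition act p u (i : nat) : R := \sum_(j < size p) p`_j * u (i + j)%N.

Lemma actE n p u i : (size p <= n)%N -> act p u i = \sum_(j < n) p`_j * u (i + j)%N.
Proof.
move=> pn; rewrite /act (big_ord_widen _ (fun j => p`_j * u (i + j)%N) pn) big_mkcond.
by apply: eq_bigr => j _; case: ltnP => // jp; rewrite nth_default ?mul0r.
Qed.

Lemma act1 u i : act 1 u i = u i.
Proof. by rewrite (@actE 1) ?size_poly1 // big_ord1 coef1 mul1r addn0. Qed.

Lemma act_XsubC_mul b q u i :
  act (('X - b%:P) * q) u i = act q u i.+1 - b * act q u i.
Proof.
rewrite (@actE (size q).+1); last first.
  by rewrite (leq_trans (size_polyMleq _ _)) // size_XsubC.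
rewrite (@actE (size q).+1 q u i) // mulr_sumr /act.
under eq_bigr => j _ do rewrite mulrBl coefB coefXM coefCM mulrBl -mulrA.
rewrite sumrB; congr (_ - _).
rewrite big_ord_recl /= mul0r add0r; apply: eq_bigr => j _.
by rewrite /bump /= add1n addSnnS.
Qed.

End ShiftOperator.

Lemma size_deriv_rat (p : {poly rat}) : (1 < size p)%N -> p^`() != 0.
Proof.
move=> p1; have [m Em] : exists m, size p = m.+2.
  by case: (size p) p1 => [|[|m]] // _; exists m.
apply/eqP => p'0; have := coef_deriv p m; rewrite p'0 coef0 => /esym/eqP.
have -> : p`_m.+1 = lead_coef p by rewrite lead_coefE Em.
by rewrite mulrn_eq0 /= lead_coef_eq0 -size_poly_eq0 Em.
Qed.

(** At a multiple root the derivative would vanish too; the minimal polynomial would then divide its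
    own derivative, which is nonzero and of smaller degree. *)
Lemma minCpoly_simple_root (alpha : algC) (q : {poly algC}) :
  minCpoly alpha = ('X - alpha%:P) * q -> ~~ root q alpha.
Proof.
have [p [Dp mon_p] min_p] := minCpolyP alpha; rewrite Dp => E.
apply/negP => rq.
have : root (map_poly ratr p^`()) alpha.
  rewrite -deriv_map E derivM derivXsubC mul1r rootE hornerD hornerM.
  by rewrite hornerXsubC subrr mul0r addr0 -rootE.
rewrite min_p => dv; have p1 : (1 < size p)%N.
  by have := size_minCpoly alpha; rewrite Dp size_map_poly.
have := dvdp_leq (size_deriv_rat p1) dv; rewrite leqNgt lt_size_deriv //.
exact: monic_neq0.
Qed.

Lemma pisot_factor (alpha : algC) : pisot alpha ->
  exists2 rs : seq algC, minCpoly alpha = ('X - alpha%:P) * \prod_(z <- rs) ('X - z%:P)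
    & {in rs, forall z, `|z| < 1}.
Proof.
move=> [_ _ conj]; have [rs Drs] := closed_field_poly_normal (minCpoly alpha).
rewrite (monicP (minCpoly_monic alpha)) scale1r in Drs.
have ars : alpha \in rs by rewrite -root_prod_XsubC -Drs root_minCpoly.
have Drs' : minCpoly alpha = ('X - alpha%:P) * \prod_(z <- rem alpha rs) ('X - z%:P).
  by rewrite Drs (perm_big _ (perm_to_rem ars)) big_cons.
exists (rem alpha rs) => // z zrs; apply: conj.
  by rewrite Drs root_prod_XsubC; apply: mem_rem zrs.
move=> za; have := minCpoly_simple_root Drs'.
by rewrite root_prod_XsubC; move: zrs; rewrite za => ->.
Qed.

Definition asymptotic (alpha : algC) (u : nat -> algC) : Prop :=
  exists c D, forall n, \sum_(i < n) `|u i - c * alpha ^+ i| <= D.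

(** The new constant [c / (alpha - b)] solves the recurrence for the main term. The errors then
    satisfy a contraction with factor [b] up to a summable perturbation, and summing it gives
    [S <= |eta 0| + |b| S + D]. *)
Lemma asymptotic_step (alpha b : algC) (u : nat -> algC) : 1 < alpha -> `|b| < 1 ->
  asymptotic alpha (fun i => u i.+1 - b * u i) -> asymptotic alpha u.
Proof.
move=> a1 b1 [c [D HD]].
have ab : alpha - b != 0.
  rewrite subr_eq0; apply/eqP => E; move: b1; rewrite -E ger0_norm.
    by move/(lt_trans a1); rewrite ltxx.
  by rewrite (le_trans ler01) // ltW.
pose c' := c / (alpha - b); pose eta i := u i - c' * alpha ^+ i.
have D0 : 0 <= D by have := HD 0%N; rewrite big_ord0.
have etaS i : `|eta i.+1| <= `|b| * `|eta i| + `|u i.+1 - b * u i - c * alpha ^+ i|.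
  have -> : eta i.+1 = b * eta i + (u i.+1 - b * u i - c * alpha ^+ i).
    have Ec : c = c' * (alpha - b) by rewrite /c' divfK.
    by rewrite /eta Ec exprS; ring.
  by rewrite (le_trans (ler_normD _ _)) // normrM.
exists c', ((`|eta 0%N| + D) / (1 - `|b|)) => n; rewrite -/(eta _).
have b1' : 0 < 1 - `|b| by rewrite subr_gt0.
rewrite ler_pdivlMr //.
set S := \sum_(i < n) _.
have SS m : \sum_(i < m.+1) `|eta i| <= `|eta 0%N| + (`|b| * \sum_(i < m) `|eta i| + D).
  rewrite big_ord_recl lerD2l mulr_sumr.
  rewrite (le_trans _ (lerD (lexx _) (HD m))) // -big_split /=.
  by apply: ler_sum => i _; exact: etaS.
have SS' : S <= `|eta 0%N| + (`|b| * S + D).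
  by apply: le_trans (SS n); rewrite big_ord_recr /= lerDl.
rewrite mulrBr mulr1 lerBlDr (le_trans SS') //.
by rewrite [S * _]mulrC -!addrA lerD2l addrC.
Qed.

Lemma asymptotic_prod (alpha : algC) (rs : seq algC) (u : nat -> algC) :
  1 < alpha -> {in rs, forall z, `|z| < 1} ->
  asymptotic alpha (act (\prod_(z <- rs) ('X - z%:P)) u) -> asymptotic alpha u.
Proof.
move=> a1; elim: rs u => [|b rs IH] u rs1.
  by rewrite big_nil => -[c [D H]]; exists c, D => n; under eq_bigr => i _ do rewrite -act1.
rewrite big_cons => -[c [D H]]; apply: IH.
  by move=> z zrs; apply: rs1; rewrite inE zrs orbT.
apply: (asymptotic_step a1 (rs1 b (mem_head _ _))); exists c, D => n.
by apply: le_trans (H n); apply: ler_sum => i _; rewrite act_XsubC_mul.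
Qed.

Lemma linear_recurrence_act (U : nat -> nat) k (a : 'I_k -> int) i :
  linear_recurrence U a ->
  act (map_poly intr (recurrence_poly a)) (fun i => (U i)%:R : algC) i = 0.
Proof.
move=> rU; set p := recurrence_poly a.
have pE j : p`_j = (j == k)%:R - \sum_(l < k) (a l) *+ (j == l :> nat).
  rewrite coefB coefXn coef_sum; congr (_ - _); apply: eq_bigr => l _.
  by rewrite coefCM coefXn mulr_natr.
have sp : (size (map_poly (intr : int -> algC) p) <= k.+1)%N.
  apply: leq_trans (size_poly _ _) _; apply/leq_sizeP => j kj; rewrite pE.
  rewrite gtn_eqF // big1 ?subr0 // => l _.
  by rewrite gtn_eqF // (ltn_trans (ltn_ord l)).
have pk : p`_k = 1.
  by rewrite pE eqxx big1 ?subr0 // => l _; rewrite gtn_eqF.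
have pj (j : 'I_k) : p`_j = - a j.
  rewrite pE ltn_eqF // (bigD1 j) //= eqxx big1 ?addr0 ?sub0r // => l lj.
  by rewrite eq_sym val_eqE (negbTE lj).
rewrite (actE _ _ sp) big_ord_recr /= coef_map /= pk mul1r.
have -> : (U (i + k)%N)%:R = ((U (i + k)%N)%:Z)%:~R :> algC by [].
rewrite rU rmorph_sum -big_split /= big1 // => j _.
by rewrite coef_map /= pj rmorphM rmorphN /= mulNr addNr.
Qed.

Lemma pisot_asymptotic (U : nat -> nat) : pisot_numeration U ->
  exists (alpha c D : algR), [/\ 1 < alpha, 0 < c &
    forall n, \sum_(i < n) `|(U i)%:R - c * alpha ^+ i| <= D].
Proof.
move=> [U0 Uinc [k [a [alpha [rU pis Ep]]]]].
have [_ a1 _] := pis; have [rs Drs rs1] := pisot_factor pis.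
have [c [D HD]] : asymptotic alpha (fun i => (U i)%:R).
  apply: (asymptotic_prod a1 rs1).
  (* After all factors but that of [alpha] have been applied, the sequence is exactly geometric with
     ratio [alpha], so there is no error. *)
  set w := act _ _; exists (w 0%N), 0 => n; rewrite big1 // => i _.
  suff -> : w i = w 0%N * alpha ^+ i by rewrite subrr normr0.
  elim: (val i) => [|{}i IH]; first by rewrite expr0 mulr1.
  have := linear_recurrence_act i rU; rewrite Ep Drs act_XsubC_mul -/w => /eqP.
  by rewrite subr_eq0 => /eqP ->; rewrite IH exprS mulrCA.
have ar : alpha \is Creal by rewrite realE (le_trans ler01) // ltW.
have D0 : 0 <= D by have := HD 0%N; rewrite big_ord0.
have Dr : D \is Creal by rewrite realE D0.
(* The constant is so far complex. As [U i] and [alpha] are real, passing to its real part can only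
   decrease the errors. *)
pose A := in_algR ar; pose C := in_algR (Creal_Re c).
have bnd n : \sum_(i < n) `|(U i)%:R - C * A ^+ i| <= in_algR Dr.
  rewrite -[_ <= _]/(val (\sum_(i < n) `|(U i)%:R - C * A ^+ i|) <= D).
  apply: le_trans (HD n); rewrite rmorph_sum; apply: ler_sum => i _ /=.
  rewrite -[X in X <= _]/(`|algRval ((U i)%:R - C * A ^+ i)|).
  rewrite rmorphB rmorphM rmorphXn rmorph_nat /=.
  have -> : (U i)%:R - 'Re c * alpha ^+ i = 'Re ((U i)%:R - c * alpha ^+ i).
    rewrite [c * _]mulrC raddfB /= ReMl ?rpredX // mulrC; congr (_ - _).
    by apply/esym/Creal_ReP; exact: realn.
  by rewrite leif_normC_Re_Creal.
exists A, C, (in_algR Dr); split=> //.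
(* With a nonpositive constant, [U n] itself would be at most the error and thus bounded by [D]. *)
rewrite ltNge; apply/negP => C0.
have [n nD] : exists n : nat, in_algR Dr < n%:R.
  by exists (Num.truncn (in_algR Dr)).+1; exact: truncnS_gt.
have := bnd n.+1; rewrite big_ord_recr /=.
set S := \sum_(i < n) _ => H.
have S0 : 0 <= S by apply: sumr_ge0.
have Un : (n%:R : algR) <= (U n)%:R by rewrite ler_nat ltnW // ltn_U.
have CA : C * A ^+ n <= 0.
  apply: mulr_le0_ge0 => //; apply: exprn_ge0.
  by rewrite -[_ <= _]/(0 <= alpha) (le_trans ler01) // ltW.
have := ler_norm ((U n)%:R - C * A ^+ n).
lra.
Qed.

(** * The sign of a word of bounded signed digits *)

Section SignAutomaton.
Variable U : nat -> nat.
Variables (k : nat) (a : 'I_k -> int).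
Hypothesis U0 : U 0 = 1%N.
Hypothesis rU : linear_recurrence U a.
Variables (alpha c D : algR).
Hypotheses (a1 : 1 < alpha) (c0 : 0 < c).
Hypothesis HD : forall n, \sum_(i < n) `|(U i)%:R - c * alpha ^+ i| <= D.

Let delta i : algR := (U i)%:R - c * alpha ^+ i.

Lemma D_ge0 : 0 <= D.
Proof. by have := HD 0; rewrite big_ord0. Qed.

Lemma alpha_gt0 : 0 < alpha.
Proof. exact: lt_trans a1. Qed.

Lemma sum_delta_shift i n : \sum_(l < n) `|delta (l + i)| <= D.
Proof.
apply: le_trans (HD (i + n)); rewrite big_split_ord /= ler_wpDl ?sumr_ge0 //.
by apply: ler_sum => l _; rewrite addnC.
Qed.

(* The entry [i] is the value of the word [e] shifted [i] places to the left;
   reading one more digit [d] maps [s] to [i |-> s (i + 1) + d U_i]. *)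
Definition sv (e : seq int) : nat -> int :=
  foldl (fun s d i => s i.+1 + d * (U i)%:Z) (fun=> 0) e.

Lemma sv_rcons e d i : sv (rcons e d) i = sv e i.+1 + d * (U i)%:Z.
Proof. by rewrite /sv foldl_rcons. Qed.

Lemma sv_cons d e i : sv (d :: e) i = d * (U (size e + i))%:Z + sv e i.
Proof.
elim/last_ind: e i => [|e b IH] i; first by rewrite /sv /= add0r addr0.
by rewrite -rcons_cons !sv_rcons IH size_rcons addrA addnS.
Qed.

Lemma sv_opp e i : sv (map -%R e) i = - sv e i.
Proof.
by elim: e => [|d e IH] /=; rewrite ?oppr0 // !sv_cons IH size_map mulNr opprD.
Qed.

Lemma sv_recurrence e i : sv e (i + k) = \sum_(j < k) a j * sv e (i + j).
Proof.
elim/last_ind: e i => [|e d IH] i; first by rewrite big1 // => j _; rewrite mulr0.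
rewrite sv_rcons -addSn IH rU mulr_sumr -big_split /=; apply: eq_bigr => j _.
by rewrite sv_rcons mulrDr addSn mulrCA.
Qed.

(** The value of the word in base [alpha]; multiplied by [c * alpha ^+ i], it is the main term of
    [sv e i]. *)
Fixpoint pisot_val (e : seq int) : algR :=
  if e is d :: e' then d%:~R * alpha ^+ size e' + pisot_val e' else 0.

Lemma pisot_val_cat e f : pisot_val (e ++ f) = pisot_val e * alpha ^+ size f + pisot_val f.
Proof.
elim: e => [|d e IH] /=; first by rewrite mul0r add0r.
by rewrite IH size_cat exprD mulrDl mulrA addrA.
Qed.

Variable A : nat.
Definition small (e : seq int) := all (fun d => `|d|%N <= A)%N e.

Lemma small_norm (d : int) : (`|d| <= A)%N -> `|d%:~R : algR| <= A%:R.
Proof. by move=> dA; rewrite -intr_norm -natr_absz ler_nat. Qed.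

(** The digits contribute their errors at distinct indices, so summability of [delta] gives a bound
    that does not depend on the length of the word. *)
Lemma sv_approx e i : small e ->
  `|(sv e i)%:~R - c * alpha ^+ i * pisot_val e| <= A%:R * D.
Proof.
move=> se; apply: le_trans (ler_wpM2l (ler0n _ A) (sum_delta_shift i (size e))).
elim: e se => [|d e IH] /=; first by rewrite /sv /= !mulr0 subrr normr0 big_ord0 mulr0.
move=> /andP[dA /IH {}IH]; rewrite sv_cons big_ord_recr /= [A%:R * _]mulrDr.
have -> : (d * (U (size e + i))%:Z + sv e i)%:~R -
    c * alpha ^+ i * (d%:~R * alpha ^+ size e + pisot_val e) =
  ((sv e i)%:~R - c * alpha ^+ i * pisot_val e) + d%:~R * delta (size e + i).
  rewrite /delta rmorphD rmorphM /= exprD; ring.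
rewrite (le_trans (ler_normD _ _)) // lerD // normrM ler_wpM2r //.
exact: small_norm.
Qed.

Lemma pisot_val_bound e : small e ->
  (alpha - 1) * `|pisot_val e| <= A%:R * alpha ^+ size e.
Proof.
have a0 := alpha_gt0; have a10 : 0 < alpha - 1 by rewrite subr_gt0.
elim: e => [|d e IH] /=; first by rewrite normr0 mulr0 expr0 mulr1 ler0n.
move=> /andP[dA /IH {}IH].
have H : `|d%:~R * alpha ^+ size e + pisot_val e| <=
    A%:R * alpha ^+ size e + `|pisot_val e|.
  rewrite (le_trans (ler_normD _ _)) // lerD2r normrM (ger0_norm (exprn_ge0 _ (ltW a0))).
  by apply: ler_wpM2r; [apply: exprn_ge0; apply: ltW | exact: small_norm].
have := ler_wpM2l (ltW a10) H; rewrite exprS; lra.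
Qed.

(** Beyond [T] the sign is settled: the first summand absorbs all later digits, by the geometric
    series, and the second one absorbs the error of [sv_approx]. *)
Let T : algR := A%:R / (alpha - 1) + A%:R * D / c.
(** An entry of index below [k] that exceeds [M] forces [pisot_val] above [T]. *)
Let M := (Num.truncn (c * alpha ^+ k * T + A%:R * D)).+1.

Lemma sv_large e f i : small e -> small f -> (i < k)%N -> M%:Z < sv e i -> 0 < sv (e ++ f) 0.
Proof.
move=> se sf ik Mi; have a0 := alpha_gt0; have a10 : 0 < alpha - 1 by rewrite subr_gt0.
have AD : 0 <= A%:R * D by rewrite mulr_ge0 ?ler0n ?D_ge0.
have T0 : 0 <= T by rewrite addr_ge0 // divr_ge0 ?ler0n // ltW.
have HX : T < pisot_val e.
  rewrite ltNge; apply/negP => XT.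
  have HM : c * alpha ^+ k * T + A%:R * D < (sv e i)%:~R.
    by apply: lt_trans (truncnS_gt _) _; rewrite -/M -[M%:R]/((M%:Z)%:~R) ltr_int.
  have H1 := sv_approx i se.
  have H2 : c * alpha ^+ i * pisot_val e <= c * alpha ^+ i * T.
    by rewrite ler_pM2l ?mulr_gt0 ?exprn_gt0.
  have H3 : c * alpha ^+ i * T <= c * alpha ^+ k * T.
    apply: ler_wpM2r => //; rewrite ler_pM2l //.
    by apply: ler_weXn2l; [exact: ltW a1 | exact: ltnW ik].
  have := ler_norm ((sv e i)%:~R - c * alpha ^+ i * pisot_val e).
  lra.
have sef : small (e ++ f) by rewrite /small all_cat; apply/andP.
have := sv_approx 0 sef; rewrite ler_norml => /andP[+ _].
rewrite expr0 mulr1 pisot_val_cat => H1.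
have Hf : - (A%:R / (alpha - 1) * alpha ^+ size f) <= pisot_val f.
  rewrite lerNl; apply: le_trans (ler_norm _) _; rewrite normrN.
  by rewrite mulrAC ler_pdivlMr // mulrC pisot_val_bound.
have p1 : 1 <= alpha ^+ size f by rewrite exprn_ege1 // ltW.
rewrite -(ltr_int algR); set p := alpha ^+ size f in Hf p1 H1 *.
have H2 : A%:R * D / c * p < pisot_val e * p + pisot_val f.
  have : T * p < pisot_val e * p by rewrite ltr_pM2r // (lt_le_trans ltr01).
  rewrite /T mulrDl; lra.
have H3 : c * (A%:R * D / c * p) < c * (pisot_val e * p + pisot_val f) by rewrite ltr_pM2l.
have E : c * (A%:R * D / c * p) = A%:R * D * p.
  by rewrite mulrA [A%:R * D / c]mulrC mulrA divff ?mul1r // gt_eqF.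
have H4 : A%:R * D <= A%:R * D * p by rewrite ler_peMr.
lra.
Qed.

Lemma sign_automaton : exists (Q : finType) (step : Q -> int -> Q) (q0 : Q) (sg : Q -> int),
  forall e, small e -> sg (foldl step q0 e) = Num.sg (sv e 0).
Proof.
pose box := {ffun 'I_k -> 'I_(2 * M).+1}.
pose dec (f : box) (i : nat) : int :=
  if insub i is Some j then (f j)%:Z - M%:Z else 0.
pose enc (s : nat -> int) : box := [ffun i : 'I_k => inord `|(s i + M%:Z)%R|%N].
(* Shifting needs the entry of index [k], which the recurrence recovers from the first [k]
   entries. *)
pose ext (f : box) (i : nat) : int :=
  if (i < k)%N then dec f i else \sum_(j < k) a j * dec f j.
pose nxt (f : box) d i : int := ext f i.+1 + d * (U i)%:Z.
pose step (q : box + bool) (d : int) : box + bool :=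
  match q with
  | inl f => if [forall i : 'I_k, `|nxt f d i| <= M%:Z] then inl (enc (nxt f d))
             else inr [exists i : 'I_k, M%:Z < nxt f d i]
  | inr b => inr b
  end.
(* An empty recurrence would make [U 0] vanish. *)
have k0 : (0 < k)%N.
  rewrite lt0n; apply/eqP => kE; move: a rU; rewrite kE => a' /(_ 0).
  by rewrite big_ord0 U0.
have encK s i : (i < k)%N -> `|s i| <= M%:Z -> dec (enc s) i = s i.
  move=> ik sM; rewrite /dec insubT /= ffunE /= inordK; first by lia.
  by rewrite ltnS; lia.
pose sg (q : box + bool) : int :=
  match q with inl f => Num.sg (dec f 0) | inr b => if b then 1 else -1 end.
exists (box + bool)%type, step, (inl (enc (fun=> 0))), sg => e se.
(* A decided state promises its sign for every continuation of the word, which is why it never has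
   to be left. *)
pose inv (q : box + bool) e := match q with
  | inl f => forall i, (i < k)%N -> sv e i = dec f i
  | inr b => forall f, small f -> Num.sg (sv (e ++ f) 0) = if b then 1 else -1
  end.
suff : inv (foldl step (inl (enc (fun=> 0))) e) e.
  case: (foldl _ _ _) => [f|b] /= H; first by rewrite H.
  by have := H [::] isT; rewrite cats0.
elim/last_ind: e se => [_ i ik|e d IH]; first by rewrite encK ?normr0.
rewrite /small all_rcons => /andP[dA se]; rewrite foldl_rcons.
move: (IH se); case: (foldl _ _ _) => [f|b] /= H; last first.
  by move=> f sf; rewrite cat_rcons; apply: H; rewrite /small /= dA.
have sve : forall i, (i < k)%N -> sv (rcons e d) i = nxt f d i.
  move=> i ik; rewrite sv_rcons /nxt /ext; congr (_ + _).
  case: ltnP => [/H //|ki]; have -> : i.+1 = (0 + k)%N by lia.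
  by rewrite sv_recurrence; apply: eq_bigr => j _; rewrite add0n H.
have sed : small (rcons e d) by rewrite /small all_rcons dA.
case: ifP => [/forallP fM i ik|/negbT]; first by rewrite sve // encK ?(fM (Ordinal ik)).
rewrite negb_forall => /existsP[i iM] /= g sg'.
case: ifP => [/existsP[j jM]|/negbT].
  by rewrite gtr0_sg // (sv_large sed sg' (ltn_ord j)) // sve.
(* Some entry is too large in modulus but none is too large itself, so one lies below [- M];
   negating all digits reduces this to the positive case. *)
rewrite negb_exists => /forallP /(_ i) iM'.
have neg : M%:Z < sv (map -%R (rcons e d)) i by rewrite sv_opp sve //; lia.
have smallN h : small h -> small (map -%R h).
  by move=> sh; rewrite /small all_map (eq_all (a2 := fun d : int => `|d|%N <= A)%N) //
    => z /=; rewrite abszN.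
have := sv_large (smallN _ sed) (smallN _ sg') (ltn_ord i) neg.
by rewrite -map_cat sv_opp oppr_gt0 => /ltr0_sg.
Qed.

End SignAutomaton.

Local Close Scope ring_scope.

(** * Automata for [V U], greedy words, equality and addition *)

Section Atoms.
Variable U : nat -> nat.
Hypotheses (U0 : U 0 = 1) (Uinc : forall i, U i < U i.+1).

Lemma V_leq m : 0 < m -> V U m <= m.
Proof.
suff H L : forall m, 0 < m -> m < U L -> V U m <= m.
  by move=> m0; apply: (H m) => //; exact: ltn_U.
elim: L => [|L IH] {}m m0 mL; first by move: mL; rewrite U0; lia.
rewrite (V_step U0 Uinc m0 mL); case: eqP => [r0|/eqP r0].
  by apply: dvdn_leq => //; apply/eqP.
apply: leq_trans (leq_mod m (U L)); apply: IH; first by rewrite lt0n.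
by rewrite ltn_pmod ?U_gt0.
Qed.

(* State [Some (b, t)]: [b] and [t] tell whether a nonzero digit of [v x],
   respectively the unique digit 1 of [v y], has been read. *)
Definition V_delta (x y : nat) (q : option (bool * bool)) (a : nat -> nat) :
    option (bool * bool) :=
  if q isn't Some (b, t) then None
  else if t then (if [&& b, a x == 0 & a y == 0] then q else None)
  else if a y == 0 then Some (b || (a x != 0), false)
  else if a y != 1 then None
  else if a x != 0 then Some (true, true)
  else if b then None else Some (false, true).

Lemma recog_V x y : recog U 5 (fun v => V U (v x) = v y).
Proof.
pose F (q : option (bool * bool)) := if q is Some (_, b) then b else false.
exists (option (bool * bool)), (V_delta x y), (Some (false, false)), F.
split; first by rewrite card_option card_prod card_bool.
have dead w : foldl (V_delta x y) None w = None by elim: w.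
have HC L v : v x < U L -> v y < U L ->
    F (foldl (V_delta x y) (Some (true, true)) (vword U L v)) = (v x == 0) && (v y == 0).
  elim: L v => [|L IH] v /= vx vy.
    by move: vx vy; rewrite U0 !ltnS !leqn0 => -> ->.
  have UL := U_gt0 U0 Uinc L.
  have E z : (v z == 0) = (v z %/ U L == 0) && (v z %% U L == 0).
    by rewrite {1}(divn_eq (v z) (U L)) addn_eq0 muln_eq0 [U L == 0]gtn_eqF // orbF.
  rewrite !E; case: (v x %/ U L == 0) => /=; last by rewrite dead.
  case: (v y %/ U L == 0) => /=; last by rewrite dead andbF.
  by rewrite IH ?ltn_pmod.
(* Here the digit 1 of [v y] was read before any nonzero digit of [v x]. This is right only in the
   last position, since [V U 0] is [U 0]. *)
have HD L v : F (foldl (V_delta x y) (Some (false, true)) (vword U L v)) = (L == 0).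
  by case: L => //= L; rewrite dead.
(* Now [v] is what remains to be read. If a nonzero digit of [v x] has passed while [v y] showed
   only zeros, another nonzero digit of [v x] must follow. *)
have key L v : v x < U L -> v y < U L -> forall b,
    F (foldl (V_delta x y) (Some (b, false)) (vword U L v)) <->
    (b -> v x != 0) /\ V U (v x) = v y.
  elim: L v => [|L IH] v vx vy b.
    move: vx vy; rewrite U0 !ltnS !leqn0 => /eqP -> /eqP -> /=.
    by split=> // -[].
  have UL := U_gt0 U0 Uinc L.
  set r := v x %% U L; set s := v y %% U L; set d := v x %/ U L; set e := v y %/ U L.
  have rL : r < U L by rewrite ltn_pmod.
  have sL : s < U L by rewrite ltn_pmod.
  have Ex : v x = d * U L + r by rewrite -divn_eq.
  have Ey : v y = e * U L + s by rewrite -divn_eq.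
  have V1 : v x != 0 -> r = 0 -> V U (v x) = U L.
    by move=> x0 r0; rewrite (V_step U0 Uinc _ vx) ?lt0n // -/r r0.
  have V2 : r != 0 -> V U (v x) = V U r /\ V U r < U L.
    move=> r0; split; last by apply: leq_ltn_trans (V_leq _) rL; rewrite lt0n.
    rewrite (V_step U0 Uinc _ vx) -/r ?(negbTE r0) //.
    by rewrite Ex ltn_addl // lt0n.
  have V3 : v x = 0 -> V U (v x) = 1 by move=> ->.
  have L1 : L = 0 \/ 1 < U L.
    by case: (L) => [|l]; [left | right; have := ltn_U U0 Uinc l.+1; lia].
  have IHb b' := IH (fun z => v z %% U L) rL sL b'.
  have HC' := HC L (fun z => v z %% U L) rL sL.
  have HD' := HD L (fun z => v z %% U L).
  rewrite /= -/d -/e; rewrite /= -/r -/s in IHb HC'.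
  case: (eqVneq e 0) => [e0|e0] /=.
    rewrite IHb; have [r0|r0] := eqVneq r 0; last first.
      have [-> Vr] := V2 r0; have -> : v y = s by rewrite Ey e0.
      by split=> -[_ H]; split=> // _; rewrite // Ex addn_eq0 negb_and r0 orbT.
    have [d0|d0] := eqVneq d 0 => /=.
      have -> : v x = r by rewrite Ex d0.
      have -> : v y = s by rewrite Ey e0.
      by rewrite orbF r0; split.
    rewrite orbT; split=> [[/(_ isT)]|[_]]; first by [].
    rewrite V1 // => [H|]; last by rewrite Ex addn_eq0 muln_eq0 negb_and negb_or d0 -lt0n UL.
    have ys : v y = s by rewrite Ey e0.
    by move: sL; lia.
  have yL : U L <= v y by rewrite Ey; nia.
  have [e1|e1] := eqVneq e 1 => /=; last first.
    rewrite dead /=; split=> // -[_ H].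
    have yL2 : 2 * U L <= v y by rewrite Ey; nia.
    have [x0|x0] := eqVneq (v x) 0; first by have := V3 x0; lia.
    have [r0|r0] := eqVneq r 0; first by have := V1 x0 r0; lia.
    by have [] := V2 r0; lia.
  have [d0|d0] := eqVneq d 0 => /=.
    have xr : v x = r by rewrite Ex d0.
    have [r0|r0] := eqVneq r 0; last first.
      have [H1 H2] := V2 r0; split=> [|[_ H]]; last by lia.
      case: (b); rewrite ?dead // HD' => /eqP L0; move: rL; rewrite L0 U0; lia.
    rewrite xr r0; case: (b) => /=; first by rewrite dead; split=> // -[/(_ isT)].
    rewrite HD'; split=> [/eqP L0|[_ H]].
      by split=> //; move: sL; rewrite Ey e1 L0 U0 /V /=; lia.
    by apply/eqP; case: L1 => // L1; move: H; rewrite /V /=; lia.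
  have x0 : v x != 0 by rewrite Ex addn_eq0 muln_eq0 negb_and negb_or d0 -lt0n UL.
  rewrite HC' x0; have [r0|r0] := eqVneq r 0 => /=.
    rewrite (V1 x0 r0) Ey e1 mul1n; split=> [/eqP ->|[_]]; first by rewrite addn0.
    by move=> H; apply/eqP; lia.
  by have [H1 H2] := V2 r0; split=> // -[_ H]; lia.
move=> L v vL; rewrite (key L v (vL x) (vL y) false); split=> [//|[]//].
Qed.

Fixpoint wval (w : seq nat) : nat :=
  if w is d :: w' then d * U (size w') + wval w' else 0.

Fixpoint greedy_word (w : seq nat) : Prop :=
  wval w < U (size w) /\ if w is _ :: w' then greedy_word w' else True.

Lemma greedy_wordP w :
  greedy_word w <-> exists2 m, m < U (size w) & w = digs U (size w) m.
Proof.
split.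
  move=> Hw; exists (wval w); first by case: (w) Hw => [[]|? ? []].
  elim: w Hw => //= d w IH [dw Hw].
  have wU : wval w < U (size w) by case: (w) Hw => [[]|? ? []].
  rewrite divnMDl ?U_gt0 // divn_small // addn0 modnMDl modn_small //.
  by rewrite -IH.
case=> m + ->; move: (size w) => L {w}.
suff H : forall L m, m < U L -> wval (digs U L m) = m /\ greedy_word (digs U L m).
  by move=> mL; have [] := H L m mL.
elim=> [|L' IH] {}m mL /=; first by move: mL; rewrite U0; case: m.
have [E Hg] := IH _ (ltn_pmod m (U_gt0 U0 Uinc L')).
by rewrite E size_digs -divn_eq.
Qed.

Variable A : nat.
Hypothesis ratio : forall i, U i.+1 <= A * U i.

Lemma A_gt0 : 0 < A.
Proof. by have := ratio 0; have := Uinc 0; rewrite U0 muln1; lia. Qed.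

Lemma digit_leq v L : v < U L.+1 -> v %/ U L <= A.
Proof.
by move=> vL; rewrite ltnW // ltn_divLR ?U_gt0 //; exact: leq_trans (ratio L).
Qed.

Lemma greedy_word_digits w : greedy_word w -> all (fun d => d <= A) w.
Proof.
elim: w => //= d w IH [dw /IH ->]; rewrite andbT ltnW //.
rewrite -(ltn_pmul2r (U_gt0 U0 Uinc (size w))).
by apply: leq_ltn_trans (leq_addr _ _) _; exact: leq_trans dw (ratio _).
Qed.

Local Open Scope ring_scope.

Lemma sv_wval w : sv U [seq - d%:Z | d <- w] 0 = - (wval w)%:Z.
Proof.
elim: w => //= d w IH; rewrite sv_cons IH size_map addn0 PoszD PoszM; ring.
Qed.

(** The inequality for a suffix [w] says that the digit 1 followed by the negated digits of [w] has
    positive value. A copy of the sign automaton is started at each position, the set of current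
    states of all copies is the new state, and [None] records a digit above [A]. *)
Lemma greedy_automaton_of_sign (Q : finType) (step : Q -> int -> Q) q0 (sg : Q -> int) :
  (forall e, small A e -> sg (foldl step q0 e) = Num.sg (sv U e 0)) ->
  greedy_automaton U (2 ^ #|Q|).+1.
Proof.
move=> Hsg; pose q1 := step q0 1.
have q1P w : all (fun d => d <= A)%N w ->
    (sg (foldl step q1 [seq - d%:Z | d <- w]) == 1) = (wval w < U (size w))%N.
  move=> sw; have := Hsg (1 :: [seq - d%:Z | d <- w]); rewrite /= -/q1 => ->.
    by rewrite sv_cons sv_wval size_map addn0 mul1r sgr_cp0 subr_gt0.
  rewrite /small /= A_gt0 /= all_map; apply: sub_all sw => d /=.
  by rewrite abszN.
pose gamma (S : option {set Q}) (d : nat) : option {set Q} :=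
  if S is Some S' then
    if (d <= A)%N then Some (q1 |: [set step q (- d%:Z) | q in S']) else None
  else None.
pose E (S : option {set Q}) := if S is Some S' then [forall q in S', sg q == 1] else false.
exists (option {set Q}), gamma, (Some [set q1]), E; split.
  by rewrite card_option -cardsT -powersetT card_powerset cardsT.
move=> w; rewrite -greedy_wordP.
have dead u : foldl gamma None u = None by elim: u.
have main u (S : {set Q}) : E (foldl gamma (Some S) u) <->
    [/\ all (fun d => d <= A)%N u,
        {in S, forall q, sg (foldl step q [seq - d%:Z | d <- u]) == 1} &
        if u is _ :: u' then greedy_word u' else True].
  elim: u S => [|d u IH] S /=.
    by split=> [/forall_inP H|[_ H _]]; [split | apply/forall_inP].
  case: ifP => [dA|dA]; last by rewrite dead; split=> // -[].
  rewrite IH; split=> [[sm HS Hu]|[sm HS Hu]].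
    have Hq1 : (wval u < U (size u))%N by rewrite -q1P // HS // !inE eqxx.
    split=> //; last by case: (u) Hq1 Hu.
    by move=> q qS; apply: (HS (step q (- d%:Z))); rewrite !inE imset_f ?orbT.
  have uU : (wval u < U (size u))%N by case: (u) Hu => [[]|? ? []].
  split=> //; last by case: (u) Hu => // ? ? [].
  move=> q; rewrite !inE => /orP[/eqP ->|/imsetP[p pS ->]]; first by rewrite q1P.
  exact: HS.
rewrite main; split=> [[sm HS Hw]|Hw].
  have := HS q1 (set11 _); rewrite q1P // => wU.
  by case: (w) wU Hw.
have sm := greedy_word_digits Hw.
have wU : (wval w < U (size w))%N by case: (w) Hw => [[]|? ? []].
split=> //; last by case: (w) Hw => // ? ? [].
by move=> q /set1P ->; rewrite q1P.
Qed.

(** By linearity, [f v] is the value of the word obtained by applying [f] to each letter, so its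
    vanishing is read off the sign. *)
Lemma recog_linear (Q : finType) (step : Q -> int -> Q) q0 (sg : Q -> int) B
    (f : (nat -> nat) -> int) :
  (forall e, small B e -> sg (foldl step q0 e) = Num.sg (sv U e 0)) ->
  (forall u v n, f (fun x => u x * n + v x)%N = f u * n%:Z + f v) ->
  (forall u, (forall x, u x <= A)%N -> `|f u| <= B)%N ->
  recog U #|Q| (fun v => f v = 0).
Proof.
move=> Hsg lin bnd.
exists Q, (fun q u => step q (f u)), q0, (fun q => sg q == 0); split=> // L v vL.
have -> w : foldl (fun q u => step q (f u)) q0 w = foldl step q0 (map f w).
  by elim: w q0 {Hsg} => //= u w IH q; rewrite IH.
have sm : small B (map f (vword U L v)).
  elim: L v vL => //= L IH v vL; rewrite bnd /= => [|x]; last exact: digit_leq.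
  by apply: IH => x; rewrite ltn_pmod ?U_gt0.
rewrite Hsg // sgr_eq0.
suff -> : sv U (map f (vword U L v)) 0 = f v by split=> /eqP.
elim: L v vL {sm} => [|L IH] v vL /=.
  have -> : v = fun=> 0%N by apply: funext => x; have := vL x; rewrite U0; case: (v x).
  have := lin (fun=> 0)%N (fun=> 0)%N 1%N; rewrite mulr1 -[LHS]/(f (fun=> 0%N)).
  by move/esym/eqP; rewrite -subr_eq0 addrK => /eqP ->.
rewrite sv_cons IH => [|x]; last by rewrite ltn_pmod ?U_gt0.
rewrite size_map size_vword addn0 -lin; congr f.
by apply: funext => x; rewrite -divn_eq.
Qed.

End Atoms.

Lemma pisot_recursive_truth (U : nat -> nat) : pisot_numeration U ->
  exists2 f, R1 f & forall phi, (holds U (fun=> 0) phi -> f (code phi) = 1) /\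
                                (~ holds U (fun=> 0) phi -> f (code phi) = 0).
Proof.
move=> pU; have [alpha [c [D [a1 c0 HD]]]] := pisot_asymptotic pU.
have [U0 Uinc [k [a [_ [rU _ _]]]]] := pU.
have [A ratio] : exists A, forall i, U i.+1 <= A * U i.
  (* From [U i.+1 <= alpha * (U i + D) + D] and [1 <= U i]. *)
  exists (Num.truncn (alpha + alpha * D + D)%R).+1 => i.
  have a0 := alpha_gt0 a1; have D0 := D_ge0 HD.
  have dD j : (`|(U j)%:R - c * alpha ^+ j| <= D)%R.
    by apply: le_trans (HD j.+1); rewrite big_ord_recr /= lerDr sumr_ge0.
  rewrite -(ler_nat algR) natrM.
  have := truncnS_gt (alpha + alpha * D + D)%R; set M := (_.+1%:R)%R => HM.
  have Ui : (1 <= (U i)%:R :> algR)%R by rewrite ler1n U_gt0.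
  have := dD i; have := dD i.+1; rewrite !ler_norml exprS => /andP[_ H1] /andP[H2 _].
  have H3 : (alpha * (c * alpha ^+ i) <= alpha * ((U i)%:R + D))%R.
    by rewrite ler_pM2l //; lra.
  have H4 : ((alpha + alpha * D + D) * (U i)%:R <= M * (U i)%:R)%R.
    by rewrite ler_wpM2r ?ler0n // ltW.
  have H5 : ((alpha * D + D) * 1 <= (alpha * D + D) * (U i)%:R)%R.
    by rewrite ler_wpM2l // addr_ge0 // mulr_ge0 // ltW.
  lra.
have [Q1 [s1 [q1 [sg1 H1]]]] := sign_automaton U0 rU a1 c0 HD A.
(* Reading [x + y - z] digit by digit yields signed digits of modulus at most [A + A]. *)
have [Q2 [s2 [q2 [sg2 H2]]]] := sign_automaton U0 rU a1 c0 HD (A + A).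
pose K := (2 ^ #|Q1|).+1 + #|Q2| + 5.
have K0 : 0 < K by [].
have HG : greedy_automaton U K.
  have [G [gamma [g0 [E [GK HE]]]]] := greedy_automaton_of_sign U0 Uinc ratio H1.
  by exists G, gamma, g0, E; split=> //; apply: leq_trans GK _; rewrite /K -addnA leq_addr.
have Q2K : #|Q2| <= K by rewrite /K; lia.
apply: (recursive_truth U0 Uinc K0 HG).
- move=> x y; apply: (recog_leq Q2K).
  apply: recog_ext (recog_linear (f := fun v => ((v x)%:Z - (v y)%:Z)%R) U0 Uinc ratio H2 _ _) _.
  + by move=> u v m; rewrite !PoszD !PoszM; ring.
  + by move=> u uA; have := uA x; have := uA y; lia.
  + by move=> v; lia.
- move=> x y z; apply: (recog_leq Q2K).
  apply: recog_ext (recog_linear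
    (f := fun v => ((v x)%:Z + (v y)%:Z - (v z)%:Z)%R) U0 Uinc ratio H2 _ _) _.
  + by move=> u v m; rewrite !PoszD !PoszM; ring.
  + by move=> u uA; have := uA x; have := uA y; have := uA z; lia.
  + by move=> v; lia.
- by move=> x y; apply: recog_leq (recog_V U0 Uinc x y); rewrite leq_addl.
- exact: R1_linear_recurrence rU.
- exact: R1_V U0 Uinc (R1_linear_recurrence rU).
Qed.

(** * One-invariant sets *)

Section Games.
Variable n : nat.
Implicit Types (p q r m : n.-tuple nat) (X : n.-tuple nat -> Prop).

Definition add_pos p m : n.-tuple nat := [tuple tnth p i + tnth m i | i < n].

Lemma add_posK p m : sub_pos (add_pos p m) m = p.
Proof. by apply: eq_from_tnth => i; rewrite !tnth_mktuple addnK. Qed.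

Lemma sub_posK p m : le_pos m p -> add_pos (sub_pos p m) m = p.
Proof. by move=> mp; apply: eq_from_tnth => i; rewrite !tnth_mktuple subnK. Qed.

Lemma le_add_pos p m : le_pos m (add_pos p m).
Proof. by move=> i; rewrite tnth_mktuple leq_addl. Qed.

Lemma add_pos0 p : add_pos p (origin n) = p.
Proof. by apply: eq_from_tnth => i; rewrite !tnth_mktuple addn0. Qed.

Definition weight p := \sum_(i < n) tnth p i.

Lemma weight_sub p m : le_pos m p -> m <> origin n -> weight (sub_pos p m) < weight p.
Proof.
move=> mp m0; have [i mi] : exists i, tnth m i != 0.
  apply: contrapT => H; apply: m0; apply: eq_from_tnth => i; rewrite tnth_mktuple.
  by apply: contrapT => /eqP mi; apply: H; exists i.
rewrite /weight (bigD1 i) //= [X in _ < X](bigD1 i) //= tnth_mktuple.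
rewrite -addSn leq_add //; first by have := mp i; lia.
by apply: leq_sum => j _; rewrite tnth_mktuple leq_subr.
Qed.

Lemma winning_or_losing (G : game n) p : winning G p \/ losing G p.
Proof.
have [w] := ubnP (weight p); elim: w p => // w IH p pw.
have [[m [Gm Lm]]|H] := pselect (exists m, G p m /\ losing G (sub_pos p m)).
  by left; exact: Winning Gm Lm.
right; constructor => m Gm.
have [//|Lm] : winning G (sub_pos p m) \/ losing G (sub_pos p m).
  apply: IH; rewrite -ltnS; apply: leq_trans pw; rewrite ltnS weight_sub //.
    exact: moves_le Gm.
  exact: moves_neq0 Gm.
by case: H; exists m.
Qed.

Lemma winning_not_losing (G : game n) p : winning G p -> ~ losing G p.
Proof.
have [w] := ubnP (weight p); elim: w p => // w IH p pw [m Gm Lm] [H].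
apply: IH (H m Gm) Lm; rewrite -ltnS; apply: leq_trans pw; rewrite ltnS weight_sub //.
  exact: moves_le Gm.
exact: moves_neq0 Gm.
Qed.

(* Since no move may join two elements of [X], the largest candidate for the set
   of moves consists of the [m] that are not differences of elements of [X]. *)
Lemma one_invariantP X : one_invariant X <->
  forall q, ~ X q -> exists p m,
    [/\ q = add_pos p m, X p & forall r, X r -> ~ X (add_pos r m)].
Proof.
split.
  move=> [G [[I HI] HX]] q Xq.
  have [[m Gm Lm]|Lq] := winning_or_losing G q; last by case: Xq; apply/HX.
  have [Im mq] := (HI q m).1 Gm.
  exists (sub_pos q m), m; split; [by rewrite sub_posK|exact/HX|].
  move=> r Xr /HX[H].
  have Gr : G (add_pos r m) m by apply/HI; split=> //; exact: le_add_pos.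
  by have := H _ Gr; rewrite add_posK => /winning_not_losing; apply; apply/HX.
move=> H.
pose I m := m <> origin n /\ forall r, X r -> ~ X (add_pos r m).
have G1 p m : I m /\ le_pos m p -> m <> origin n by case=> [[]].
have G2 p m : I m /\ le_pos m p -> le_pos m p by case.
pose G := @Game n (fun p m => I m /\ le_pos m p) G1 G2.
exists G; split; first by exists I.
move=> p; have [w] := ubnP (weight p); elim: w p => // w IH p pw.
have IHm m : G p m -> X (sub_pos p m) <-> losing G (sub_pos p m).
  case=> [[m0 _] mp]; apply: IH; rewrite -ltnS; apply: leq_trans pw.
  by rewrite ltnS weight_sub.
split=> [Xp|Lp].
  constructor => m Gm; have [//|/(IHm m Gm) Xm] := winning_or_losing G (sub_pos p m).
  by have [[_ /(_ _ Xm)]] := Gm; rewrite sub_posK //; case: Gm.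
apply: contrapT => Xp; have [q [m [E Xq Hm]]] := H p Xp.
have Gm : G p m.
  split; last by rewrite E; exact: le_add_pos.
  (* A zero [m] would put [p] itself in [X]. *)
  by split=> // m0; apply: Xp; rewrite E m0 add_pos0.
case: Lp => /(_ m Gm) /winning_not_losing; apply; apply/IHm => //.
by rewrite E add_posK.
Qed.

End Games.

(** * The sentence expressing one-invariance *)

Lemma eq_holds U f v w : {in free_vars f, v =1 w} -> holds U v f <-> holds U w f.
Proof.
have upd x d g v' w' : {in [seq y <- free_vars g | y != x], v' =1 w'} ->
    {in free_vars g, update v' x d =1 update w' x d}.
  by move=> H y yg; rewrite /update; case: eqP => // /eqP yx; apply: H; rewrite mem_filter yx.
elim: f v w => /= [t1 t2|f IH|f IHf g IHg|f IHf g IHg|f IHf g IHg|x f IH|x f IH] v w H.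
- have E1 : eval U v t1 = eval U w t1 by apply: eq_eval => y yt; apply: H; rewrite mem_cat yt.
  have E2 : eval U v t2 = eval U w t2.
    by apply: eq_eval => y yt; apply: H; rewrite mem_cat yt orbT.
  by rewrite E1 E2.
- by rewrite (IH v w).
- by rewrite (IHf v w) 1?(IHg v w) // => y yf; apply: H; rewrite mem_cat yf ?orbT.
- by rewrite (IHf v w) 1?(IHg v w) // => y yf; apply: H; rewrite mem_cat yf ?orbT.
- by rewrite (IHf v w) 1?(IHg v w) // => y yf; apply: H; rewrite mem_cat yf ?orbT.
- by split=> -[d Hd]; exists d; apply/(IH _ _ (upd _ d _ _ _ H)).
- by split=> Hd d; apply/(IH _ _ (upd _ d _ _ _ H)).
Qed.

Definition exs lo n f := foldr FEx f (iota lo n).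
Definition alls lo n f := foldr FAll f (iota lo n).
(** The language has no constant for truth; a trivial equation stands for the empty conjunction. *)
Definition eqs n (l r : nat -> term) :=
  foldr FAnd (FEq (TVar 0) (TVar 0)) [seq FEq (l i) (r i) | i <- iota 0 n].

Fixpoint set_block (v : nat -> nat) (lo : nat) (s : seq nat) : nat -> nat :=
  if s is d :: s' then set_block (update v lo d) lo.+1 s' else v.

Lemma set_blockE v lo s y :
  set_block v lo s y = if (lo <= y) && (y < lo + size s) then nth 0 s (y - lo) else v y.
Proof.
elim: s v lo => [|d s IH] v lo /=; first by rewrite addn0; case: ifP => //; lia.
rewrite IH /update; case: eqP => [->|/eqP yl].
  by rewrite ltnn leqnn subnn /= addnS ltnS leq_addr.
have -> : (lo <= y < lo + (size s).+1) = (lo < y < lo.+1 + size s) by lia.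
by case: ifP => // /andP[ly _]; rewrite -[y - lo]prednK ?subn_gt0 //= -subnS.
Qed.

Lemma holds_exs U v lo n f :
  holds U v (exs lo n f) <-> exists t : n.-tuple nat, holds U (set_block v lo t) f.
Proof.
suff H : holds U v (exs lo n f) <->
    exists2 s : seq nat, size s = n & holds U (set_block v lo s) f.
  rewrite H; split=> [[s /eqP ss Hs]|[t Ht]]; first by exists (Tuple ss).
  by exists t; rewrite ?size_tuple.
elim: n v lo => [|n IH] v lo; first by split=> [H|[[]//]]; exists [::].
rewrite /exs /= -/(exs lo.+1 n f); split=> [[d /IH[s ss Hs]]|[[|d s] // [ss] Hs]].
  by exists (d :: s); rewrite /= ?ss.
by exists d; apply/IH; exists s.
Qed.

Lemma holds_alls U v lo n f :
  holds U v (alls lo n f) <-> forall t : n.-tuple nat, holds U (set_block v lo t) f.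
Proof.
suff H : holds U v (alls lo n f) <->
    forall s : seq nat, size s = n -> holds U (set_block v lo s) f.
  rewrite H; split=> [Hs t|Ht s /eqP ss]; first by apply: Hs; rewrite size_tuple.
  exact: (Ht (Tuple ss)).
elim: n v lo => [|n IH] v lo; first by split=> [H [] //|H]; exact: (H [::]).
rewrite /alls /= -/(alls lo.+1 n f); split=> [H [|d s] // [ss]|H d].
  by have /IH := H d; apply.
by apply/IH => s ss; apply: (H (d :: s)); rewrite /= ss.
Qed.

Lemma holds_eqs U v n l r :
  holds U v (eqs n l r) <-> forall i, i < n -> eval U v (l i) = eval U v (r i).
Proof.
suff H s : holds U v (foldr FAnd (FEq (TVar 0) (TVar 0)) [seq FEq (l i) (r i) | i <- s])
    <-> {in s, forall i, eval U v (l i) = eval U v (r i)}.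
  rewrite H; split=> Hi i; first by move=> il; apply: Hi; rewrite mem_iota.
  by rewrite mem_iota => /Hi.
elim: s => //= j s IH; rewrite IH; split=> [[Ej Es] i|Hi].
  by rewrite inE => /orP[/eqP ->|/Es].
by split=> [|i si]; apply: Hi; rewrite inE ?eqxx ?si ?orbT.
Qed.

Section Sentence.
Variables (U : nat -> nat) (n : nat).

Definition block (v : nat -> nat) (b : nat) : n.-tuple nat := [tuple v (b * n + i) | i < n].

Lemma block_set v b (t : n.-tuple nat) b' :
  block (set_block v (b * n) t) b' = if b' == b then t else block v b'.
Proof.
apply: eq_from_tnth => i; rewrite tnth_mktuple set_blockE size_tuple.
have [->|bb] := eqVneq b' b.
  by rewrite leq_addr ltn_add2l ltn_ord /= addKn -tnth_nth.
rewrite tnth_mktuple; case: ifP => // /andP[h1 h2]; case/eqP: bb.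
by have := ltn_ord i; nia.
Qed.

Definition vars (b i : nat) : term := TVar (b * n + i).

Lemma holds_eq_block v b b' :
  holds U v (eqs n (vars b) (vars b')) <-> block v b = block v b'.
Proof.
rewrite holds_eqs; split=> [H|E i il].
  by apply: eq_from_tnth => i; rewrite !tnth_mktuple; exact: (H i (ltn_ord i)).
by have := congr1 (fun t => tnth t (Ordinal il)) E; rewrite !tnth_mktuple.
Qed.

Lemma holds_add_block v b b1 b2 :
  holds U v (eqs n (vars b) (fun i => TAdd (vars b1 i) (vars b2 i))) <->
  block v b = add_pos (block v b1) (block v b2).
Proof.
rewrite holds_eqs; split=> [H|E i il].
  by apply: eq_from_tnth => i; rewrite !tnth_mktuple; exact: (H i (ltn_ord i)).
by have := congr1 (fun t => tnth t (Ordinal il)) E; rewrite !tnth_mktuple.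
Qed.

(* Block 0 consists of the free variables of [phi]; capture of the variables of
   block [b] inside [phi] is harmless because they are not free there. *)
Definition mem_block (b : nat) (phi : formula) : formula :=
  exs (0 * n) n (FAnd (eqs n (vars 0) (vars b)) phi).

Lemma holds_mem_block phi (X : n.-tuple nat -> Prop) v b : defines U phi X -> 0 < b ->
  holds U v (mem_block b phi) <-> X (block v b).
Proof.
move=> [fv HX] b0; rewrite holds_exs.
have E (t : n.-tuple nat) : holds U (set_block v (0 * n) t) phi <-> X t.
  rewrite HX; apply: eq_holds => y /fv yn.
  by rewrite set_blockE mul0n size_tuple yn subn0.
split=> [[t /= []]|Xb].
  by rewrite holds_eq_block !block_set eqxx gtn_eqF // => -> /E; rewrite -?E.
exists (block v b); split; last exact/E.
by rewrite holds_eq_block !block_set eqxx gtn_eqF.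
Qed.

(** This is the criterion of [one_invariantP]: blocks 1, 2, 3 and 4 hold [q], [p], [m] and [r]. The
    sum of [r] and [m] gets block 5 because [mem_block] speaks of blocks and not of terms. *)
Definition invariance_sentence (phi : formula) : formula :=
  alls (1 * n) n (FImp (FNot (mem_block 1 phi))
    (exs (2 * n) n (exs (3 * n) n
      (FAnd (eqs n (vars 1) (fun i => TAdd (vars 2 i) (vars 3 i)))
      (FAnd (mem_block 2 phi)
      (alls (4 * n) n (alls (5 * n) n
        (FImp (eqs n (vars 5) (fun i => TAdd (vars 4 i) (vars 3 i)))
        (FImp (mem_block 4 phi) (FNot (mem_block 5 phi))))))))))).

Lemma holds_invariance_sentence phi (X : n.-tuple nat -> Prop) v : defines U phi X ->
  holds U v (invariance_sentence phi) <-> one_invariant X.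
Proof.
move=> dX; have memE b w : 0 < b -> holds U w (mem_block b phi) <-> X (block w b).
  exact: holds_mem_block.
rewrite one_invariantP holds_alls; split=> H q.
  move=> Xq; have /= := H q; rewrite memE // block_set => /(_ Xq).
  move/holds_exs => [p] /holds_exs[m] /= [].
  rewrite holds_add_block memE // !block_set /= => E [Xp Hr].
  exists p, m; split=> // r Xr Xrm.
  have [s Es] : exists s, s = add_pos r m by exists (add_pos r m).
  move: Hr => /holds_alls/(_ r)/holds_alls/(_ s) /=.
  by rewrite holds_add_block !memE // !block_set /= Es; apply.
rewrite /= memE // block_set => /H[p [m [E Xp Hm]]].
apply/holds_exs; exists p; apply/holds_exs; exists m => /=.
rewrite holds_add_block memE // !block_set /=; split=> //; split=> //.
apply/holds_alls => r; apply/holds_alls => s /=.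
by rewrite holds_add_block !memE // !block_set /= => -> /Hm.
Qed.

(** * The code of the sentence as a recursive function of the code of the formula *)

Definition recursive_on_codes (T : formula -> formula) : Prop :=
  exists2 g, R1 g & forall phi, code (T phi) = g (code phi).

Lemma roc_id : recursive_on_codes id.
Proof. by exists id. Qed.

Lemma roc_const f : recursive_on_codes (fun=> f).
Proof. by exists (fun=> code f) => // k g _; exact: recs_const. Qed.

Lemma roc_not T : recursive_on_codes T -> recursive_on_codes (fun f => FNot (T f)).
Proof.
move=> [g Rg E]; exists (fun c => cantor 1 (g c)) => [k f Hf|phi] /=; last by rewrite E.
by apply: R2_cantor; [exact: recs_const | exact: Rg].
Qed.

Lemma roc_and S T : recursive_on_codes S -> recursive_on_codes T ->
  recursive_on_codes (fun f => FAnd (S f) (T f)).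
Proof.
move=> [g Rg E] [h Rh E'].
exists (fun c => cantor 2 (cantor (g c) (h c))) => [k f Hf|phi] /=; last by rewrite E E'.
by apply: R2_cantor; [exact: recs_const | apply: R2_cantor; [exact: Rg|exact: Rh]].
Qed.

Lemma roc_imp S T : recursive_on_codes S -> recursive_on_codes T ->
  recursive_on_codes (fun f => FImp (S f) (T f)).
Proof.
move=> [g Rg E] [h Rh E'].
exists (fun c => cantor 4 (cantor (g c) (h c))) => [k f Hf|phi] /=; last by rewrite E E'.
by apply: R2_cantor; [exact: recs_const | apply: R2_cantor; [exact: Rg|exact: Rh]].
Qed.

Lemma roc_quant (c : nat) (F : nat -> formula -> formula) lo l T :
  (forall x f, code (F x f) = cantor c (cantor x (code f))) ->
  recursive_on_codes T -> recursive_on_codes (fun f => foldr F (T f) (iota lo l)).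
Proof.
move=> HF [g Rg E]; elim: (iota lo l) => [|x s [h Rh Eh]] /=; first by exists g.
exists (fun y => cantor c (cantor x (h y))) => [k f Hf|phi]; last by rewrite HF Eh.
by do 2 (apply: R2_cantor; first exact: recs_const); exact: Rh.
Qed.

Lemma roc_exs lo l T : recursive_on_codes T -> recursive_on_codes (fun f => exs lo l (T f)).
Proof. exact: roc_quant. Qed.

Lemma roc_alls lo l T : recursive_on_codes T -> recursive_on_codes (fun f => alls lo l (T f)).
Proof. exact: roc_quant. Qed.

Lemma roc_invariance_sentence : recursive_on_codes invariance_sentence.
Proof.
have mem b : recursive_on_codes (mem_block b).
  by apply: roc_exs; apply: roc_and; [exact: roc_const | exact: roc_id].
apply: roc_alls; apply: roc_imp; first exact: roc_not.
do 2 apply: roc_exs; apply: roc_and; first exact: roc_const.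
apply: roc_and => //; do 2 apply: roc_alls; apply: roc_imp; first exact: roc_const.
by apply: roc_imp => //; apply: roc_not.
Qed.

End Sentence.

Theorem theorem4p2 (n : nat) (hn : 1 <= n) (U : nat -> nat)
    (hU : pisot_numeration U) :
  @decidable_on_definable U n
    (fun P : n.-tuple nat -> Prop => P (origin n))
    (fun P : n.-tuple nat -> Prop => one_invariant P).
Proof.
have [f Rf Hf] := pisot_recursive_truth hU.
have [g Rg Hg] := roc_invariance_sentence n.
exists (fun t => f (g (nth 0 t 0))); split.
  exact: Rf _ _ (Rg _ _ (recs_var (isT : 0 < 1))).
move=> X phi dX _; rewrite /= -Hg.
have [H1 H2] := Hf (invariance_sentence n phi).
have E := holds_invariance_sentence (fun=> 0) dX.
by split=> [/E|H]; [exact: H1 | apply: H2 => /E].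
Qed.
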